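(* Let $n\ge1$ and $u\in\mathbb C$ with $u\neq0$, and let $\ddot{\mathfrak H}^-$ and $\ddot{\mathfrak H}^-_{tr}$ be the rational and the trigonometric spin double affine Hecke algebras with the same parameter $u$. (1) There exists a unique homomorphism of superalgebras $\iota^-:\ddot{\mathfrak H}^-\to\ddot{\mathfrak H}^-_{tr}$ which extends the identity map on the subalgebra $\mathbb C S_n^-$ and such that $$\iota^-(y_i)=e^{\epsilon_i},\qquad \iota^-(\xi_i)=e^{-\epsilon_i}\Bigl(\zeta_i-u\sum_{k<i}[k,i]\Bigr)\qquad(1\le i\le n).$$ Moreover, $\iota^-$ is injective. (2) The homomorphism $\iota^-$ extends to an algebra isomorphism $$\mathbb C[y_1^{\pm1},\dots,y_n^{\pm1}]\otimes_{\mathbb C[y_1,\dots,y_n]}\ddot{\mathfrak H}^-\xrightarrow{\ \cong\ }\ddot{\mathfrak H}^-_{tr}.$$ The inverse map $j^-$ is an extension of the identity map on $\mathbb C S_n^-$ such that $$j^-(e^{\epsilon_i})=y_i,\qquad j^-(\zeta_i)=y_i\xi_i+u\sum_{k<i}[k,i].$$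
   Context: The spin symmetric group algebra $\mathbb C S_n^-$ is the $\mathbb C$-algebra generated by $t_1,\dots,t_{n-1}$ subject to $t_i^2=1$, $t_it_{i+1}t_i=t_{i+1}t_it_{i+1}$, and $t_it_j=-t_jt_i$ for $|i-j|>1$. For $1\le i<j\le n$ set $[i,j]=-[j,i]=(-1)^{j-i-1}t_{j-1}\cdots t_{i+1}t_it_{i+1}\cdots t_{j-1}$. The rational spin double affine Hecke algebra $\ddot{\mathfrak H}^-$ with parameter $u$ is the $\mathbb C$-algebra generated by $\xi_i,y_i$ ($1\le i\le n$) and $t_i$ ($1\le i\le n-1$), subject to the relations $t_i^2=1$, $t_it_{i+1}t_i=t_{i+1}t_it_{i+1}$, $t_it_j=-t_jt_i$ for $|i-j|>1$, and: $\xi_i\xi_j=-\xi_j\xi_i$, $y_iy_j=y_jy_i$ for $i\neq j$; $t_i\xi_i=-\xi_{i+1}t_i$, $t_iy_i=y_{i+1}t_i$; $t_j\xi_i=-\xi_it_j$, $t_jy_i=y_it_j$ for $i\neq j,j+1$; the commutator relations $y_i\xi_j-\xi_jy_i=u[i,j]$ for $i\ne j$, and $y_i\xi_i-\xi_iy_i=u\sum_{k\neq i}[i,k]$. It is a superalgebra with $y_i$ even and $\xi_i,t_i$ odd. The trigonometric spin double affine Hecke algebra $\ddot{\mathfrak H}^-_{tr}$ with parameter $u$ is the $\mathbb C$-algebra generated by $e^{\pm\epsilon_i},\zeta_i$ ($1\le i\le n$) and $t_i$ ($1\le i\le n-1$), subject to the relations $t_i^2=1$, $t_it_{i+1}t_i=t_{i+1}t_it_{i+1}$,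 $t_it_j=-t_jt_i$ for $|i-j|>1$, and: $e^{\epsilon_i}e^{-\epsilon_i}=1$ (so $e^{-\epsilon_i}$ is the two-sided inverse of $e^{\epsilon_i}$), $e^{\epsilon_i}e^{\epsilon_j}=e^{\epsilon_j}e^{\epsilon_i}$; $t_ie^{\epsilon_i}=e^{\epsilon_{i+1}}t_i$, $t_ie^{\epsilon_j}=e^{\epsilon_j}t_i$ ($j\ne i,i+1$); $\zeta_{i+1}t_i+t_i\zeta_i=u$, $\zeta_jt_i=-t_i\zeta_j$ ($j\neq i,i+1$); $\zeta_i\zeta_j=-\zeta_j\zeta_i$ ($i\ne j$); $\zeta_ie^\eta-e^\eta\zeta_i=u\sum_{k\neq i}\mathrm{sgn}(k-i)\dfrac{e^\eta-e^{s_{ki}(\eta)}}{1-e^{\mathrm{sgn}(k-i)(\epsilon_k-\epsilon_i)}}[k,i]$ for all $\eta\in\bigoplus_i\mathbb Z\epsilon_i$. Here $e^{\eta}=\prod_i(e^{\epsilon_i})^{m_i}$ for $\eta=\sum_im_i\epsilon_i$, the transposition $s_{ki}$ exchanges $\epsilon_k$ and $\epsilon_i$, and the quotient is a Laurent polynomial in the $e^{\epsilon_i}$. It is a superalgebra with $e^{\pm\epsilon_i}$ even and $\zeta_i,t_i$ odd. The algebra $\mathbb C[y_1^{\pm1},\dots,y_n^{\pm1}]\otimes_{\mathbb C[y_1,\dots,y_n]}\ddot{\mathfrak H}^-$ is the localization of $\ddot{\mathfrak H}^-$ obtained by inverting $y_1,\dots,y_n$ (equivalently, by inverting the element $y_1\cdots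 y_n$, which is central in $\ddot{\mathfrak H}^-$). *)

(* Defs.v *)
From HB Require Import structures.
From mathcomp Require Import all_boot all_order all_algebra.
From mathcomp Require Import perm finmap complex monalg.
From mathcomp Require Import boolp reals.

Set Implicit Arguments.
Unset Strict Implicit.
Unset Printing Implicit Defensive.

Import GRing.Theory.
Local Open Scope ring_scope.
Local Open Scope quotient_scope.

(* The free associative algebra K<G>: the monoid algebra of words over G.     *)
Notation freeAlg K G := {malg K[{fmonom G}]}.

(* Locked constants keep unification from unfolding the algebras.             *)
Fact alg_key : unit. Proof. exact: tt. Qed.

Definition free_gen (K : comNzRingType) (G : choiceType) : G -> freeAlg K G :=
  locked_with alg_key (fun g => << fmu g >>).

Section PresentedAlgebra.
Variables (K : comNzRingType) (G : choiceType).
Variable rel : freeAlg K G -> freeAlg K G -> Prop.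

Inductive rel_ideal : freeAlg K G -> Prop :=
| rel_ideal0 : rel_ideal 0
| rel_idealD p q : rel_ideal p -> rel_ideal q -> rel_ideal (p + q)
| rel_ideal_gen a p q b : rel p q -> rel_ideal (a * (p - q) * b).

Lemma rel_idealMl a p : rel_ideal p -> rel_ideal (a * p).
Proof.
elim=> [|p1 p2 _ h1 _ h2|b p1 p2 c h].
- by rewrite mulr0; exact: rel_ideal0.
- by rewrite mulrDr; exact: rel_idealD.
- by rewrite !mulrA; exact: rel_ideal_gen.
Qed.

Lemma rel_idealMr a p : rel_ideal p -> rel_ideal (p * a).
Proof.
elim=> [|p1 p2 _ h1 _ h2|b p1 p2 c h].
- by rewrite mul0r; exact: rel_ideal0.
- by rewrite mulrDl; exact: rel_idealD.
- by rewrite -(mulrA _ c a); exact: rel_ideal_gen.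
Qed.

Lemma rel_idealZ (a : K) p : rel_ideal p -> rel_ideal (a *: p).
Proof. by move=> /(rel_idealMl a%:A); rewrite -scalerAl mul1r. Qed.

Lemma rel_idealN p : rel_ideal p -> rel_ideal (- p).
Proof. by move=> /(rel_idealMl (-1)); rewrite mulN1r. Qed.

Lemma rel_idealB p q : rel_ideal p -> rel_ideal q -> rel_ideal (p - q).
Proof. by move=> hp /rel_idealN; exact: rel_idealD. Qed.

Definition pres_eqv (p q : freeAlg K G) : bool := `[< rel_ideal (p - q) >].

Lemma pres_eqv_refl : reflexive pres_eqv.
Proof. by move=> p; apply/asboolP; rewrite subrr; exact: rel_ideal0. Qed.

Lemma pres_eqv_sym : symmetric pres_eqv.
Proof.
by move=> p q; apply/asboolP/asboolP => /rel_idealN; rewrite opprB.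
Qed.

Lemma pres_eqv_trans : transitive pres_eqv.
Proof.
move=> q p r /asboolP hpq /asboolP hqr; apply/asboolP.
by have := rel_idealD hpq hqr; rewrite addrA subrK.
Qed.

Canonical pres_eqv_equiv :=
  EquivRel pres_eqv pres_eqv_refl pres_eqv_sym pres_eqv_trans.

(* The K-algebra generated by G subject to the relations p = q for rel p q.   *)
Definition presented : Type := {eq_quot pres_eqv}.

HB.instance Definition _ := Choice.on presented.
HB.instance Definition _ := EqQuotient.on presented.

Definition pres_pi : freeAlg K G -> presented :=
  locked_with alg_key (fun p => \pi p).

Lemma pres_piP p q : pres_pi p = pres_pi q <-> rel_ideal (p - q).
Proof.
rewrite /pres_pi unlock; split=> [/eqmodP/asboolP //|h].
by apply/eqmodP/asboolP.
Qed.

Lemma pres_reprK x : pres_pi (repr x) = x.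
Proof. by rewrite /pres_pi unlock reprK. Qed.

Lemma pres_ind (P : presented -> Prop) :
  (forall p, P (pres_pi p)) -> forall x, P x.
Proof. by move=> h x; rewrite -(pres_reprK x). Qed.

Definition pres_add : presented -> presented -> presented :=
  locked_with alg_key (fun x y => pres_pi (repr x + repr y)).
Definition pres_opp : presented -> presented :=
  locked_with alg_key (fun x => pres_pi (- repr x)).
Definition pres_mul : presented -> presented -> presented :=
  locked_with alg_key (fun x y => pres_pi (repr x * repr y)).
Definition pres_scale : K -> presented -> presented :=
  locked_with alg_key (fun a x => pres_pi (a *: repr x)).

Lemma pres_repr_pi p : rel_ideal (repr (pres_pi p) - p).
Proof. by apply/pres_piP; rewrite pres_reprK. Qed.


Lemma pres_addE p q : pres_add (pres_pi p) (pres_pi q) = pres_pi (p + q).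
Proof.
by rewrite /pres_add unlock; apply/pres_piP; rewrite opprD addrACA; apply: rel_idealD; exact: pres_repr_pi.
Qed.

Lemma pres_oppE p : pres_opp (pres_pi p) = pres_pi (- p).
Proof.
by rewrite /pres_opp unlock; apply/pres_piP; rewrite -opprD; apply: rel_idealN; exact: pres_repr_pi.
Qed.

Lemma pres_mulE p q : pres_mul (pres_pi p) (pres_pi q) = pres_pi (p * q).
Proof.
rewrite /pres_mul unlock; apply/pres_piP.
have hx := pres_repr_pi p; have hy := pres_repr_pi q.
move: (repr (pres_pi p)) (repr (pres_pi q)) hx hy => x y hx hy.
have -> : x * y - p * q = (x - p) * y + p * (y - q).
  by rewrite mulrBl mulrBr addrA subrK.
by apply: rel_idealD; [exact: rel_idealMr | exact: rel_idealMl].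
Qed.

Lemma pres_scaleE a p : pres_scale a (pres_pi p) = pres_pi (a *: p).
Proof.
by rewrite /pres_scale unlock; apply/pres_piP; rewrite -scalerBr; apply: rel_idealZ; exact: pres_repr_pi.
Qed.

Fact pres_addA : associative pres_add.
Proof.
elim/pres_ind=> p; elim/pres_ind=> q; elim/pres_ind=> r.
by rewrite !pres_addE addrA.
Qed.

Fact pres_addC : commutative pres_add.
Proof.
by elim/pres_ind=> p; elim/pres_ind=> q; rewrite !pres_addE addrC.
Qed.

Fact pres_add0 : left_id (pres_pi 0) pres_add.
Proof. by elim/pres_ind=> p; rewrite pres_addE add0r. Qed.

Fact pres_addN : left_inverse (pres_pi 0) pres_opp pres_add.
Proof. by elim/pres_ind=> p; rewrite pres_oppE pres_addE addNr. Qed.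

HB.instance Definition _ :=
  GRing.isZmodule.Build presented pres_addA pres_addC pres_add0 pres_addN.

Fact pres_piD p q : pres_pi (p + q) = pres_pi p + pres_pi q.
Proof. by rewrite -[LHS]pres_addE. Qed.

Fact pres_mulA : associative pres_mul.
Proof.
elim/pres_ind=> p; elim/pres_ind=> q; elim/pres_ind=> r.
by rewrite !pres_mulE mulrA.
Qed.

Fact pres_mul1 : left_id (pres_pi 1) pres_mul.
Proof. by elim/pres_ind=> p; rewrite pres_mulE mul1r. Qed.

Fact pres_mulr1 : right_id (pres_pi 1) pres_mul.
Proof. by elim/pres_ind=> p; rewrite pres_mulE mulr1. Qed.

Fact pres_mulDl : left_distributive pres_mul +%R.
Proof.
elim/pres_ind=> p; elim/pres_ind=> q; elim/pres_ind=> r.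
by rewrite -pres_piD !pres_mulE -pres_piD mulrDl.
Qed.

Fact pres_mulDr : right_distributive pres_mul +%R.
Proof.
elim/pres_ind=> p; elim/pres_ind=> q; elim/pres_ind=> r.
by rewrite -pres_piD !pres_mulE -pres_piD mulrDr.
Qed.

HB.instance Definition _ := GRing.Zmodule_isPzRing.Build presented
  pres_mulA pres_mul1 pres_mulr1 pres_mulDl pres_mulDr.

Fact pres_scaleA a b x : pres_scale a (pres_scale b x) = pres_scale (a * b) x.
Proof. by elim/pres_ind: x => p; rewrite !pres_scaleE scalerA. Qed.

Fact pres_scale1 : left_id 1 pres_scale.
Proof. by elim/pres_ind=> p; rewrite pres_scaleE scale1r. Qed.

Fact pres_scaleDr : right_distributive pres_scale +%R.
Proof.
move=> a; elim/pres_ind=> p; elim/pres_ind=> q.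
by rewrite -pres_piD !pres_scaleE -pres_piD scalerDr.
Qed.

Fact pres_scaleDl x : {morph pres_scale^~ x : a b / a + b}.
Proof.
elim/pres_ind: x => p a b.
by rewrite !pres_scaleE -pres_piD scalerDl.
Qed.

HB.instance Definition _ := GRing.Zmodule_isLmodule.Build K presented
  pres_scaleA pres_scale1 pres_scaleDr pres_scaleDl.

Fact pres_pi_monoid_morphism : monoid_morphism pres_pi.
Proof. by split=> [|p q]; [|rewrite -[LHS]pres_mulE]. Qed.

Fact pres_pi_linear : linear pres_pi.
Proof.
by move=> a p q; rewrite pres_piD -pres_scaleE.
Qed.

HB.instance Definition _ :=
  GRing.isLinear.Build K (freeAlg K G) presented *:%R pres_pi pres_pi_linear.
HB.instance Definition _ :=
  GRing.isMonoidMorphism.Build (freeAlg K G) presented pres_pi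
    pres_pi_monoid_morphism.

Definition pres_gen (g : G) : presented := pres_pi (free_gen K g).

Lemma pres_pi1 : pres_pi 1 = 1.
Proof. by case: pres_pi_monoid_morphism. Qed.

Lemma pres_piM p q : pres_pi (p * q) = pres_pi p * pres_pi q.
Proof. by case: pres_pi_monoid_morphism => _; apply. Qed.

Lemma pres_piN p : pres_pi (- p) = - pres_pi p.
Proof. by rewrite -[LHS]pres_oppE. Qed.

Lemma pres_piZ a p : pres_pi (a *: p) = a *: pres_pi p.
Proof. by rewrite -[LHS]pres_scaleE. Qed.

Lemma pres_rel p q : rel p q -> pres_pi p = pres_pi q.
Proof.
move=> h; apply/pres_piP; rewrite -[p - q]mul1r -[1 * _]mulr1.
exact: rel_ideal_gen.
Qed.
End PresentedAlgebra.

(* (Unital) homomorphisms of K-algebras; stated as predicates because the     *)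
(* library's bundled algebra morphisms require 1 != 0.                        *)
Definition alg_morphism (K : comNzRingType) (G H : choiceType)
    (r : freeAlg K G -> freeAlg K G -> Prop)
    (s : freeAlg K H -> freeAlg K H -> Prop)
    (f : presented r -> presented s) : Prop :=
  linear f /\ monoid_morphism f.

Section Lift.
Variables (K : comNzRingType) (G : choiceType) (B : pzRingType).
Variables (phi : {rmorphism K -> B}) (h : G -> B).

Definition word_eval (w : {fmonom G}) : B := \prod_(g <- w) h g.

Definition free_eval (p : freeAlg K G) : B :=
  \sum_(w <- msupp p) phi p@_w * word_eval w.

Lemma free_evalEw (d : {fset {fmonom G}}) p : (msupp p `<=` d)%fset ->
  free_eval p = \sum_(w <- d) phi p@_w * word_eval w.
Proof.
move=> le; rewrite [LHS](big_fset_incl _ le) => //= w _ /mcoeff_outdom ->.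
by rewrite rmorph0 mul0r.
Qed.

Lemma free_evalU c w : free_eval << c *g w >> = phi c * word_eval w.
Proof. by rewrite (free_evalEw msuppU_le) big_seq_fset1 mcoeffUU. Qed.

Lemma free_eval_is_additive : zmod_morphism free_eval.
Proof.
move=> p q; pose d := (msupp p `|` msupp q)%fset.
rewrite (@free_evalEw d (p - q)) ?msuppB_le //.
rewrite (@free_evalEw d p) ?fsubsetUl // (@free_evalEw d q) ?fsubsetUr //.
by rewrite -sumrB; apply: eq_bigr => w _; rewrite mcoeffB rmorphB mulrBl.
Qed.

HB.instance Definition _ :=
  GRing.isZmodMorphism.Build (freeAlg K G) B free_eval free_eval_is_additive.

Lemma free_eval_gen g : free_eval (free_gen K g) = h g.
Proof.
by rewrite /free_gen unlock free_evalU rmorph1 mul1r /word_eval fmU big_seq1.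
Qed.

Hypothesis phi_central : forall a x, phi a * x = x * phi a.

Lemma free_eval_is_monoid_morphism : monoid_morphism free_eval.
Proof.
split=> [|p q]; first by rewrite free_evalU rmorph1 mul1r /word_eval fm1 big_nil.
rewrite malgME raddf_sum /= mulr_suml; apply: eq_bigr => v _.
rewrite raddf_sum /= mulr_sumr; apply: eq_bigr => w _.
rewrite free_evalU rmorphM /word_eval fmM big_cat /= !mulrA; congr (_ * _).
by rewrite -!mulrA; congr (_ * _); rewrite phi_central.
Qed.

Lemma free_eval1 : free_eval 1 = 1.
Proof. by case: free_eval_is_monoid_morphism. Qed.

Lemma free_evalM p q : free_eval (p * q) = free_eval p * free_eval q.
Proof. by case: free_eval_is_monoid_morphism => _; apply. Qed.

Lemma free_evalD p q : free_eval (p + q) = free_eval p + free_eval q.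
Proof. exact: raddfD. Qed.

Lemma free_evalN p : free_eval (- p) = - free_eval p.
Proof. exact: raddfN. Qed.

Lemma free_evalZ a p : free_eval (a *: p) = phi a * free_eval p.
Proof.
rewrite (free_evalEw (msuppZ_le _ _)) /free_eval mulr_sumr.
by apply: eq_bigr => w _; rewrite mcoeffZ rmorphM mulrA.
Qed.

Section Quotient.
Variable rel : freeAlg K G -> freeAlg K G -> Prop.

Definition pres_lift (x : presented rel) : B := free_eval (repr x).

Hypothesis hrel : forall p q, rel p q -> free_eval p = free_eval q.

Lemma pres_lift_pi p : pres_lift (pres_pi rel p) = free_eval p.
Proof.
apply/eqP; rewrite -subr_eq0 /pres_lift -free_evalN -free_evalD; apply/eqP.
elim: (pres_repr_pi rel p) => [|p1 p2 _ h1 _ h2|a p1 p2 b /hrel h12].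
- exact: raddf0.
- by rewrite free_evalD h1 h2 addr0.
- by rewrite 2!free_evalM free_evalD free_evalN h12 subrr mulr0 mul0r.
Qed.

Lemma pres_lift_gen g : pres_lift (pres_gen rel g) = h g.
Proof. by rewrite /pres_gen pres_lift_pi free_eval_gen. Qed.

Lemma pres_liftD : {morph pres_lift : x y / x + y}.
Proof.
elim/pres_ind=> p; elim/pres_ind=> q.
by rewrite -pres_piD !pres_lift_pi free_evalD.
Qed.

Lemma pres_lift_monoid_morphism : monoid_morphism pres_lift.
Proof.
split=> [|x y]; first by rewrite -pres_pi1 pres_lift_pi free_eval1.
elim/pres_ind: x => p; elim/pres_ind: y => q.
by rewrite -pres_piM !pres_lift_pi free_evalM.
Qed.

Lemma pres_liftZ a x : pres_lift (a *: x) = phi a * pres_lift x.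
Proof.
elim/pres_ind: x => p.
by rewrite -pres_piZ !pres_lift_pi free_evalZ.
Qed.
End Quotient.
End Lift.

Section StructureMap.
Variables (K : comNzRingType) (G : choiceType).
Variable rel : freeAlg K G -> freeAlg K G -> Prop.

Lemma freeAlg_scalerAr (a : K) (p q : freeAlg K G) : a *: (p * q) = p * (a *: q).
Proof.
transitivity (p * a%:MP * q); last by rewrite -mulrA mul_malgC.
rewrite [LHS]scalerAl; congr (_ * q); rewrite -[LHS]mul_malgC [p]monalgE mulr_sumr mulr_suml.
apply: eq_bigr => w _.
by rewrite !malgM_def !fgmulUU mul1m mulm1 mulrC.
Qed.

Lemma pres_scalerAl (a : K) (x y : presented rel) : a *: (x * y) = (a *: x) * y.
Proof.
elim/pres_ind: x => p; elim/pres_ind: y => q.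
by rewrite -pres_piM -!pres_piZ -pres_piM scalerAl.
Qed.

Lemma pres_scalerAr (a : K) (x y : presented rel) : a *: (x * y) = x * (a *: y).
Proof.
elim/pres_ind: x => p; elim/pres_ind: y => q.
by rewrite -pres_piM -!pres_piZ -pres_piM freeAlg_scalerAr.
Qed.

Definition pres_scal (a : K) : presented rel := a *: (1 : presented rel).

Lemma pres_scal_is_additive : zmod_morphism pres_scal.
Proof. by move=> a b; rewrite /pres_scal scalerBl. Qed.

Lemma pres_scal_is_monoid_morphism : monoid_morphism pres_scal.
Proof.
split=> [|a b]; first exact: scale1r.
by rewrite /pres_scal -pres_scalerAl mul1r scalerA.
Qed.

HB.instance Definition _ :=
  GRing.isZmodMorphism.Build K (presented rel) pres_scal pres_scal_is_additive.
HB.instance Definition _ :=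
  GRing.isMonoidMorphism.Build K (presented rel) pres_scal
    pres_scal_is_monoid_morphism.

Lemma pres_scalE a x : pres_scal a * x = a *: x.
Proof. by rewrite /pres_scal -pres_scalerAl mul1r. Qed.

Lemma pres_scal_central a x : pres_scal a * x = x * pres_scal a.
Proof. by rewrite pres_scalE -pres_scalerAr mulr1. Qed.
End StructureMap.

Section AlgMorphism.
Variables (K : comNzRingType) (G H : choiceType).
Variable r : freeAlg K G -> freeAlg K G -> Prop.
Variable s : freeAlg K H -> freeAlg K H -> Prop.

Lemma alg_morphismD (f : presented r -> presented s) x y :
  alg_morphism f -> f (x + y) = f x + f y.
Proof. by case=> flin _; rewrite -[x in LHS]scale1r flin scale1r. Qed.

Lemma alg_morphism0 (f : presented r -> presented s) : alg_morphism f -> f 0 = 0.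
Proof.
by move=> fD; apply: (addrI (f 0)); rewrite -alg_morphismD // !addr0.
Qed.

Lemma alg_morphismZ (f : presented r -> presented s) a x :
  alg_morphism f -> f (a *: x) = a *: f x.
Proof.
by move=> fA; have [flin _] := fA; rewrite -[LHS]/(f _) -[a *: x]addr0 flin
  alg_morphism0 // addr0.
Qed.

Lemma alg_morphism_ext (f g : presented r -> presented s) :
  alg_morphism f -> alg_morphism g ->
  (forall x, f (pres_gen r x) = g (pres_gen r x)) -> f =1 g.
Proof.
move=> fA gA fg; elim/pres_ind=> p; rewrite [p]monalgE raddf_sum /=.
have [_ [f1 fM]] := fA; have [_ [g1 gM]] := gA.
rewrite (big_morph f (fun x y => alg_morphismD x y fA) (alg_morphism0 fA)).
rewrite (big_morph g (fun x y => alg_morphismD x y gA) (alg_morphism0 gA)).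
apply: eq_bigr => w _.
have -> : << p@_w *g w >> = p@_w *: << w >> :> freeAlg K G.
  by apply/malgP => v; rewrite mcoeffZ 2!mcoeffU mulr_natr.
rewrite pres_piZ (alg_morphismZ _ _ fA) (alg_morphismZ _ _ gA); congr (_ *: _).
case: w => w; elim: w => [|x w IHw].
  by rewrite -fmoneE -[<< _ >>]/(1 : freeAlg K G) pres_pi1 f1 g1.
have -> : << FMonom (x :: w) >> = free_gen K x * << FMonom w >> :> freeAlg K G.
  by rewrite /free_gen unlock malgM_def fgmulUU mulr1; congr (<< _ >>); apply/eqP; rewrite fmP fmM fmU.
by rewrite pres_piM fM gM IHw fg.
Qed.

Lemma pres_lift_alg_morphism (h : G -> presented s) :
  (forall p q, r p q -> free_eval (pres_scal s) h p = free_eval (pres_scal s) h q) ->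
  alg_morphism (pres_lift (pres_scal s) h (rel := r)).
Proof.
move=> hr; have cen := pres_scal_central (rel := s).
split; last exact: pres_lift_monoid_morphism.
by move=> a x y; rewrite pres_liftD // pres_liftZ // pres_scalE.
Qed.
End AlgMorphism.

Section Localization.
Variables (K : comNzRingType) (G : choiceType).
Variable rel : freeAlg K G -> freeAlg K G -> Prop.
Variables (I : choiceType) (s : I -> presented rel).
Notation A := (presented rel).

Let emb (x : A) : freeAlg K (A + I)%type := free_gen K (inl x).
Let inv (i : I) : freeAlg K (A + I)%type := free_gen K (inr i).

(* One generator for every element of A, with the operations of A as          *)
(* relations, and one generator for the inverse of each s i.                  *)
Inductive loc_rel : freeAlg K (A + I)%type -> freeAlg K (A + I)%type -> Prop :=
| loc_rel1 : loc_rel (emb 1) 1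
| loc_relD x y : loc_rel (emb (x + y)) (emb x + emb y)
| loc_relM x y : loc_rel (emb (x * y)) (emb x * emb y)
| loc_relZ a x : loc_rel (emb (a *: x)) (a *: emb x)
| loc_rel_mulV i : loc_rel (emb (s i) * inv i) 1
| loc_rel_Vmul i : loc_rel (inv i * emb (s i)) 1.

Definition loc (x : A) : presented loc_rel := pres_gen loc_rel (inl x).
Definition loc_inv (i : I) : presented loc_rel := pres_gen loc_rel (inr i).

Lemma loc_alg_morphism : alg_morphism loc.
Proof.
have locD x y : loc (x + y) = loc x + loc y.
  by rewrite -[RHS]pres_piD; exact/pres_rel/loc_relD.
have locZ a x : loc (a *: x) = a *: loc x.
  by rewrite -[RHS]pres_piZ; exact/pres_rel/loc_relZ.
split=> [a x y|]; first by rewrite locD locZ.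
split=> [|x y]; first by rewrite -[RHS](pres_pi1 loc_rel); exact/pres_rel/loc_rel1.
by rewrite -[RHS]pres_piM; exact/pres_rel/loc_relM.
Qed.

Lemma loc_mulV i : loc (s i) * loc_inv i = 1.
Proof.
rewrite -[LHS]pres_piM -[RHS](pres_pi1 loc_rel).
exact/pres_rel/loc_rel_mulV.
Qed.

Lemma loc_Vmul i : loc_inv i * loc (s i) = 1.
Proof.
rewrite -[LHS]pres_piM -[RHS](pres_pi1 loc_rel).
exact/pres_rel/loc_rel_Vmul.
Qed.

Lemma loc_universal (H : choiceType) (r : freeAlg K H -> freeAlg K H -> Prop)
    (f : A -> presented r) (g : I -> presented r) :
  alg_morphism f -> (forall i, f (s i) * g i = 1) ->
  (forall i, g i * f (s i) = 1) ->
  exists2 F : presented loc_rel -> presented r,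
    alg_morphism F /\ (forall x, F (loc x) = f x) &
    forall F' : presented loc_rel -> presented r,
      alg_morphism F' -> (forall x, F' (loc x) = f x) -> F' =1 F.
Proof.
move=> hf fgK gfK; pose h (a : A + I) := match a with inl x => f x | inr i => g i end.
have cen := pres_scal_central (rel := r).
have hrel p q : loc_rel p q ->
    free_eval (pres_scal r) h p = free_eval (pres_scal r) h q.
  case=> [|x y|x y|a x|i|i].
  - by rewrite free_eval_gen (free_eval1 h cen); case: hf => _ [].
  - rewrite free_evalD 3!free_eval_gen; exact: alg_morphismD.
  - by rewrite (free_evalM h cen) 3!free_eval_gen; case: hf => _ [_]; apply.
  - by rewrite free_evalZ 2!free_eval_gen pres_scalE; exact: alg_morphismZ.
  - by rewrite (free_evalM h cen) 2!free_eval_gen (free_eval1 h cen); exact: fgK.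
  - by rewrite (free_evalM h cen) 2!free_eval_gen (free_eval1 h cen); exact: gfK.
have hF := pres_lift_alg_morphism hrel.
have Floc x : pres_lift (pres_scal r) h (loc x) = f x.
  exact: (pres_lift_gen (pres_scal_central (rel := r)) hrel (inl x)).
exists (pres_lift (pres_scal r) h (rel := loc_rel)); first by split.
move=> F' hF' F'loc; apply: (alg_morphism_ext hF' hF) => -[x|i].
  by rewrite [LHS]F'loc [RHS]Floc.
rewrite (pres_lift_gen (pres_scal_central (rel := r)) hrel) /=.
have [_ [F'1 F'M]] := hF'.
rewrite -[LHS]mul1r -(gfK i) -mulrA -F'loc -F'M.
by rewrite [X in F' X]loc_mulV F'1 mulr1.
Qed.
End Localization.

Notation localization s := (presented (loc_rel s)).

Definition word_parity (G : choiceType) (odd_gen : pred G) (w : {fmonom G}) : bool :=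
  odd (count odd_gen w).

(* x is homogeneous of parity d (true for odd): x is the class of a linear    *)
(* combination of words of parity d. With homogeneous relations, this is the  *)
(* superalgebra grading in which the generators g with odd_gen g are odd and  *)
(* the others are even.                                                       *)
Definition homogeneous (K : comNzRingType) (G : choiceType)
    (r : freeAlg K G -> freeAlg K G -> Prop)
    (odd_gen : pred G) (d : bool) (x : presented r) : Prop :=
  exists2 p : freeAlg K G, x = pres_pi r p &
    forall w, w \in msupp p -> word_parity odd_gen w = d.

Definition superalg_morphism (K : comNzRingType) (G H : choiceType)
    (r : freeAlg K G -> freeAlg K G -> Prop)
    (s : freeAlg K H -> freeAlg K H -> Prop) (oG : pred G) (oH : pred H)
    (f : presented r -> presented s) : Prop :=
  alg_morphism f /\
  forall d x, homogeneous oG d x -> homogeneous oH d (f x).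

(* Conventions: indices are 0-based. The index k : 'I_n.-1 of t_k stands for  *)
(* the pair of adjacent positions k, k+1 of 'I_n.                             *)
Section Relations.
Variables (A : pzRingType) (n : nat).

Section Spin.
Variable t : 'I_n.-1 -> A.

Inductive spin_rel : A -> A -> Prop :=
| spin_sqr i : spin_rel (t i * t i) 1
| spin_braid (i j : 'I_n.-1) : j = i.+1 :> nat ->
    spin_rel (t i * t j * t i) (t j * t i * t j)
| spin_anti (i j : 'I_n.-1) : (i.+1 < j)%N || (j.+1 < i)%N ->
    spin_rel (t i * t j) (- (t j * t i)).

(* (-1)^(j-i-1) t_(j-1) ... t_(i+1) t_i t_(i+1) ... t_(j-1), for i < j        *)
Definition bracket_lt (i j : 'I_n) : A :=
  (-1) ^+ (j - i.+1) *
  ((\prod_(k <- rev (enum 'I_n.-1) | (i <= k < j)%N) t k) *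
   (\prod_(k < n.-1 | (i < k < j)%N) t k)).

(* [i,j]; the value 0 at i = j is junk *)
Definition bracket (i j : 'I_n) : A :=
  if (i < j)%N then bracket_lt i j
  else if (j < i)%N then - bracket_lt j i else 0.
End Spin.

Inductive rat_rel (u : A) (t : 'I_n.-1 -> A) (xi y : 'I_n -> A) :
  A -> A -> Prop :=
| rat_spin p q : spin_rel t p q -> rat_rel u t xi y p q
| rat_xi_xi i j : i != j -> rat_rel u t xi y (xi i * xi j) (- (xi j * xi i))
| rat_y_y i j : i != j -> rat_rel u t xi y (y i * y j) (y j * y i)
| rat_t_xi (k : 'I_n.-1) (i j : 'I_n) : i = k :> nat -> j = k.+1 :> nat ->
    rat_rel u t xi y (t k * xi i) (- (xi j * t k))
| rat_t_y (k : 'I_n.-1) (i j : 'I_n) : i = k :> nat -> j = k.+1 :> nat ->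
    rat_rel u t xi y (t k * y i) (y j * t k)
| rat_t_xi_far (k : 'I_n.-1) (i : 'I_n) : i <> k :> nat -> i <> k.+1 :> nat ->
    rat_rel u t xi y (t k * xi i) (- (xi i * t k))
| rat_t_y_far (k : 'I_n.-1) (i : 'I_n) : i <> k :> nat -> i <> k.+1 :> nat ->
    rat_rel u t xi y (t k * y i) (y i * t k)
| rat_y_xi i j : i != j ->
    rat_rel u t xi y (y i * xi j - xi j * y i) (u * bracket t i j)
| rat_y_xi_diag i :
    rat_rel u t xi y (y i * xi i - xi i * y i)
      (u * \sum_(k < n | k != i) bracket t i k).

(* The lattice of the eta = \sum_i (eta i) epsilon_i.                         *)
Notation lattice := {ffun 'I_n -> int}.

Definition epsilon (i : 'I_n) : lattice := [ffun j => (j == i)%:R].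

Definition swap_lattice (k i : 'I_n) (eta : lattice) : lattice :=
  [ffun j => eta (tperm k i j)].

Section Laurent.
(* e i and e' i stand for e^(epsilon_i) and e^(- epsilon_i) *)
Variables e e' : 'I_n -> A.

Definition int_exp (i : 'I_n) (m : int) : A :=
  match m with Posz p => e i ^+ p | Negz p => e' i ^+ p.+1 end.

Definition lat_exp (eta : lattice) : A := \prod_(i < n) int_exp i (eta i).

(* The Laurent polynomial (e^eta - e^(eta - c alpha)) / (1 - e^alpha)         *)
Definition geom_quot (eta alpha : lattice) (c : int) : A :=
  match c with
  | Posz p => - \sum_(j < p) lat_exp (eta - alpha *+ j.+1)
  | Negz p => \sum_(j < p.+1) lat_exp (eta + alpha *+ j)
  end.

(* (e^eta - e^(s_ki eta)) / (1 - e^(sgn(k-i)(epsilon_k - epsilon_i)));        *)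
(* see swap_latticeE and swap_quotP.                                          *)
Definition swap_root (k i : 'I_n) : lattice :=
  if (i < k)%N then epsilon k - epsilon i else epsilon i - epsilon k.
Definition swap_coef (k i : 'I_n) (eta : lattice) : int :=
  if (i < k)%N then eta k - eta i else eta i - eta k.
Definition swap_quot (k i : 'I_n) (eta : lattice) : A :=
  geom_quot eta (swap_root k i) (swap_coef k i eta).

Lemma swap_latticeE (k i : 'I_n) (eta : lattice) : k != i ->
  swap_lattice k i eta = eta - swap_root k i *~ swap_coef k i eta.
Proof.
move=> ki; have mzE (f : lattice) c j : (f *~ c) j = f j * c.
  case: c => p; first by rewrite -pmulrn ffunMnE -mulr_natr natz.
  by rewrite NegzE mulrNz ffunE -pmulrn ffunMnE -mulr_natr natz mulrN.
apply/ffunP => j; rewrite !ffunE mzE /swap_root /swap_coef.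
case: ifP => _; rewrite !ffunE; case: tpermP => [->|->|/eqP jk /eqP ji].
- by rewrite eqxx (negbTE ki) subr0 mul1r opprB addrC subrK.
- by rewrite eqxx eq_sym (negbTE ki) sub0r mulN1r opprK addrC subrK.
- by rewrite (negbTE jk) (negbTE ji) subrr mul0r subr0.
- by rewrite eqxx (negbTE ki) sub0r mulN1r opprK addrC subrK.
- by rewrite eqxx eq_sym (negbTE ki) subr0 mul1r opprB addrC subrK.
- by rewrite (negbTE jk) (negbTE ji) subrr mul0r subr0.
Qed.

Hypothesis eV : forall i, e i * e' i = 1.
Hypothesis Ve : forall i, e' i * e i = 1.
Hypothesis eC : forall i j, e i * e j = e j * e i.

Lemma int_exp_comm i j a b : GRing.comm (int_exp i a) (int_exp j b).
Proof.
have comV x l : GRing.comm x (e l) -> GRing.comm x (e' l).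
  rewrite /GRing.comm => xC; rewrite -[LHS]mul1r -(Ve l) -!mulrA; congr (_ * _).
  by rewrite (mulrA (e l)) -xC -mulrA eV mulr1.
have ee' k l : GRing.comm (e k) (e' l) by exact/comV/eC.
have e'e' k l : GRing.comm (e' k) (e' l) by apply/comV/commr_sym/ee'.
case: a => a; case: b => b /=; apply/commrX/commr_sym/commrX;
  by [exact: eC | exact: ee' | exact/commr_sym/ee' | exact: e'e'].
Qed.

Lemma int_expD i a b : int_exp i (a + b) = int_exp i a * int_exp i b.
Proof.
have e1 a' : int_exp i (a' + 1) = int_exp i a' * e i.
  case: a' => [p|[|p]]; first by rewrite -PoszD addn1 /= exprSr.
    by rewrite /= Ve.
  have -> : Negz p.+1 + 1 = Negz p by rewrite !NegzE -(addn1 p.+1) PoszD opprD subrK.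
  by rewrite /= (exprSr _ p.+1) -mulrA Ve mulr1.
have eN1 a' : int_exp i (a' - 1) = int_exp i a' * e' i.
  by rewrite -{2}(subrK 1 a') e1 -mulrA eV mulr1.
elim/int_ind: b => [|p IH|p IH]; first by rewrite addr0 mulr1.
  by rewrite -addn1 PoszD addrA !e1 IH mulrA.
by rewrite -addn1 PoszD opprD addrA !eN1 IH mulrA.
Qed.

Lemma lat_exp0 : lat_exp 0 = 1.
Proof. by rewrite /lat_exp big1 // => i _; rewrite ffunE. Qed.

Lemma lat_expD eta theta : lat_exp (eta + theta) = lat_exp eta * lat_exp theta.
Proof.
rewrite /lat_exp -prodrM_comm; last by move=> *; exact: int_exp_comm.
by apply: eq_bigr => i _; rewrite ffunE int_expD.
Qed.

Lemma geom_quotP eta alpha c :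
  geom_quot eta alpha c * (1 - lat_exp alpha) =
  lat_exp eta - lat_exp (eta - alpha *~ c).
Proof.
case: c => p; last first.
  rewrite [in RHS]NegzE mulrNz opprK /= -pmulrn; elim: p.+1 => [|q IH].
    by rewrite big_ord0 mul0r mulr0n addr0 subrr.
  rewrite big_ord_recr /= mulrDl IH mulrBr mulr1 -lat_expD.
  by rewrite [in RHS]mulrSr [in RHS](addrA eta) addrA subrK.
rewrite /= -pmulrn; elim: p => [|q IH].
  by rewrite big_ord0 oppr0 mul0r mulr0n !subr0 subrr.
rewrite big_ord_recr /= opprD mulrDl IH mulNr mulrBr mulr1 -lat_expD.
have -> : eta - alpha *+ q.+1 + alpha = eta - alpha *+ q.
  by rewrite mulrSr opprD addrA subrK.
by rewrite opprB addrA subrK.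
Qed.

Lemma swap_quotP (k i : 'I_n) (eta : lattice) : k != i ->
  swap_quot k i eta * (1 - lat_exp (swap_root k i)) =
  lat_exp eta - lat_exp (swap_lattice k i eta).
Proof. by move=> ki; rewrite geom_quotP swap_latticeE. Qed.
End Laurent.

Inductive trig_rel (u : A) (t : 'I_n.-1 -> A) (zeta e e' : 'I_n -> A) :
  A -> A -> Prop :=
| trig_spin p q : spin_rel t p q -> trig_rel u t zeta e e' p q
| trig_e_V i : trig_rel u t zeta e e' (e i * e' i) 1
| trig_V_e i : trig_rel u t zeta e e' (e' i * e i) 1
| trig_e_e i j : trig_rel u t zeta e e' (e i * e j) (e j * e i)
| trig_t_e (k : 'I_n.-1) (i j : 'I_n) : i = k :> nat -> j = k.+1 :> nat ->
    trig_rel u t zeta e e' (t k * e i) (e j * t k)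
| trig_t_e_far (k : 'I_n.-1) (j : 'I_n) : j <> k :> nat -> j <> k.+1 :> nat ->
    trig_rel u t zeta e e' (t k * e j) (e j * t k)
| trig_zeta_t (k : 'I_n.-1) (i j : 'I_n) : i = k :> nat -> j = k.+1 :> nat ->
    trig_rel u t zeta e e' (zeta j * t k + t k * zeta i) u
| trig_zeta_t_far (k : 'I_n.-1) (j : 'I_n) :
    j <> k :> nat -> j <> k.+1 :> nat ->
    trig_rel u t zeta e e' (zeta j * t k) (- (t k * zeta j))
| trig_zeta_zeta i j : i != j ->
    trig_rel u t zeta e e' (zeta i * zeta j) (- (zeta j * zeta i))
| trig_zeta_e i (eta : lattice) :
    trig_rel u t zeta e e'
      (zeta i * lat_exp e e' eta - lat_exp e e' eta * zeta i)
      (u * \sum_(k < n | k != i)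
         (-1) ^+ (k < i)%N * swap_quot e e' k i eta * bracket t k i).
End Relations.

Inductive rat_gen (n : nat) : Type :=
| RatT of 'I_n.-1 | RatXi of 'I_n | RatY of 'I_n.
Arguments RatT {n}. Arguments RatXi {n}. Arguments RatY {n}.

Inductive trig_gen (n : nat) : Type :=
| TrigT of 'I_n.-1 | TrigZeta of 'I_n | TrigE of 'I_n | TrigEV of 'I_n.
Arguments TrigT {n}. Arguments TrigZeta {n}.
Arguments TrigE {n}. Arguments TrigEV {n}.

Section Generators.
Variable n : nat.

Let rat_enc (g : rat_gen n) : 'I_n.-1 + ('I_n + 'I_n) :=
  match g with
  | RatT i => inl i | RatXi i => inr (inl i) | RatY i => inr (inr i)
  end.
Let rat_dec (g : 'I_n.-1 + ('I_n + 'I_n)) : rat_gen n :=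
  match g with
  | inl i => RatT i | inr (inl i) => RatXi i | inr (inr i) => RatY i
  end.
Fact rat_encK : cancel rat_enc rat_dec. Proof. by case. Qed.
HB.instance Definition _ := Choice.copy (rat_gen n) (can_type rat_encK).

Let trig_enc (g : trig_gen n) : 'I_n.-1 + ('I_n + ('I_n + 'I_n)) :=
  match g with
  | TrigT i => inl i | TrigZeta i => inr (inl i)
  | TrigE i => inr (inr (inl i)) | TrigEV i => inr (inr (inr i))
  end.
Let trig_dec (g : 'I_n.-1 + ('I_n + ('I_n + 'I_n))) : trig_gen n :=
  match g with
  | inl i => TrigT i | inr (inl i) => TrigZeta i
  | inr (inr (inl i)) => TrigE i | inr (inr (inr i)) => TrigEV i
  end.
Fact trig_encK : cancel trig_enc trig_dec. Proof. by case. Qed.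
HB.instance Definition _ := Choice.copy (trig_gen n) (can_type trig_encK).

Definition rat_odd (g : rat_gen n) : bool :=
  match g with RatT _ | RatXi _ => true | RatY _ => false end.
Definition trig_odd (g : trig_gen n) : bool :=
  match g with TrigT _ | TrigZeta _ => true | TrigE _ | TrigEV _ => false end.
End Generators.

Lemma spin_rel_transfer (A A' B : pzRingType) (n : nat)
    (t : 'I_n.-1 -> A) (t' : 'I_n.-1 -> A') (f : A -> B) (g : A' -> B) :
  monoid_morphism f -> {morph f : x / - x} ->
  monoid_morphism g -> {morph g : x / - x} ->
  (forall i, f (t i) = g (t' i)) ->
  (forall p q, spin_rel t' p q -> g p = g q) ->
  forall p q, spin_rel t p q -> f p = f q.
Proof.
move=> [f1 fM] fN [g1 gM] gN fg gr p q [i|i j ij|i j ij].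
- by have := gr _ _ (spin_sqr t' i); rewrite fM gM f1 g1 fg.
- by have := gr _ _ (spin_braid t' ij); rewrite !fM !gM !fg.
- by have := gr _ _ (spin_anti t' ij); rewrite fN gN !fM !gM !fg.
Qed.

Section SpinDAHA.
Variables (K : comNzRingType) (n : nat) (u : K).

Definition spin_pres : freeAlg K 'I_n.-1 -> freeAlg K 'I_n.-1 -> Prop :=
  spin_rel (free_gen K (G := 'I_n.-1)).

Definition rat_pres : freeAlg K (rat_gen n) -> freeAlg K (rat_gen n) -> Prop :=
  rat_rel u%:A (fun i => free_gen K (RatT i))
    (fun i => free_gen K (RatXi i)) (fun i => free_gen K (RatY i)).

Definition trig_pres :
    freeAlg K (trig_gen n) -> freeAlg K (trig_gen n) -> Prop :=
  trig_rel u%:A (fun i => free_gen K (TrigT i))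
    (fun i => free_gen K (TrigZeta i))
    (fun i => free_gen K (TrigE i)) (fun i => free_gen K (TrigEV i)).

Definition rat_t (i : 'I_n.-1) := pres_gen rat_pres (RatT i).
Definition rat_xi (i : 'I_n) := pres_gen rat_pres (RatXi i).
Definition rat_y (i : 'I_n) := pres_gen rat_pres (RatY i).

Definition trig_t (i : 'I_n.-1) := pres_gen trig_pres (TrigT i).
Definition trig_zeta (i : 'I_n) := pres_gen trig_pres (TrigZeta i).
Definition trig_e (i : 'I_n) := pres_gen trig_pres (TrigE i).
Definition trig_eV (i : 'I_n) := pres_gen trig_pres (TrigEV i).

(* These stand for the inclusions of C S_n^- as a subalgebra.                 *)
Definition spin_to_rat : presented spin_pres -> presented rat_pres :=
  pres_lift (pres_scal rat_pres) rat_t (rel := spin_pres).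
Definition spin_to_trig : presented spin_pres -> presented trig_pres :=
  pres_lift (pres_scal trig_pres) trig_t (rel := spin_pres).

Lemma spin_pres_eval (G : choiceType) (r : freeAlg K G -> freeAlg K G -> Prop)
    (h : 'I_n.-1 -> G) :
  (forall p q, spin_rel (fun i => free_gen K (h i)) p q -> r p q) ->
  forall p q, spin_pres p q ->
    free_eval (pres_scal r) (fun i => pres_gen r (h i)) p =
    free_eval (pres_scal r) (fun i => pres_gen r (h i)) q.
Proof.
move=> hr; apply: (@spin_rel_transfer _ _ _ _ _ (fun i => free_gen K (h i)) _
  (pres_pi r)).
- exact: (free_eval_is_monoid_morphism _ (pres_scal_central (rel := r))).
- exact: free_evalN.
- exact: pres_pi_monoid_morphism.
- exact: pres_piN.
- by move=> i; exact: free_eval_gen.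
- by move=> p q /hr; exact: pres_rel.
Qed.

Lemma spin_to_rat_alg_morphism : alg_morphism spin_to_rat.
Proof. by apply/pres_lift_alg_morphism/spin_pres_eval/rat_spin. Qed.

Lemma spin_to_trig_alg_morphism : alg_morphism spin_to_trig.
Proof. by apply/pres_lift_alg_morphism/spin_pres_eval/trig_spin. Qed.

Lemma spin_to_rat_t i : spin_to_rat (pres_gen spin_pres i) = rat_t i.
Proof.
apply: (pres_lift_gen (pres_scal_central (rel := _))).
exact/spin_pres_eval/rat_spin.
Qed.

Lemma spin_to_trig_t i : spin_to_trig (pres_gen spin_pres i) = trig_t i.
Proof.
apply: (pres_lift_gen (pres_scal_central (rel := _))).
exact/spin_pres_eval/trig_spin.
Qed.
End SpinDAHA.

Notation spin_group_alg K n := (presented (@spin_pres K n)).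
Notation rat_sDAHA n u := (presented (@rat_pres _ n u)).
Notation trig_sDAHA n u := (presented (@trig_pres _ n u)).

(* C[y_1^(+-1), ..., y_n^(+-1)] (x)_(C[y_1, ..., y_n]) (rational algebra), that *)
(* is, the localization inverting y_1, ..., y_n.                               *)
Notation rat_sDAHA_loc n u := (localization (@rat_y _ n u)).

(* Main.v *)
Require Import Defs.
From HB Require Import structures.
From mathcomp Require Import all_boot all_order all_algebra.
From mathcomp Require Import perm zify finmap monalg.
From mathcomp Require Import boolp functions.
From mathcomp Require Import complex reals.

Set Implicit Arguments.
Unset Strict Implicit.
Unset Printing Implicit Defensive.

Import GRing.Theory Num.Theory.
Local Open Scope ring_scope.

(** Write H for the rational and H' for the trigonometric algebra.  The map
    iota is a change of generators.  With N_i = \sum_(k < i) [k,i] and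
    x_i = y_i xi_i, the element zeta_i corresponds to x_i + u N_i, and y_i to
    e^(epsilon_i).  Once the y_i are invertible, each set of defining relations
    implies the other ([rat_rel_trig], [trig_rel_rat]).  All of this rests on
    the bracket [i,j] being an odd analogue of the transposition of i and j: it
    moves indices like that transposition, up to one sign for every odd object
    that it passes ([t_bracket], [bracket_act]).  In particular the
    Jucys-Murphy elements N_i anticommute with each other, which gives
      zeta_i zeta_j + zeta_j zeta_i = y_i y_j (xi_i xi_j + xi_j xi_i)
    ([xi_anticommP]).  The relation between zeta_i and e^eta has to be checked
    for eta = epsilon_j only, because both of its sides are twisted derivations
    in eta ([zeta_lat]); there it says that [xi_i, y_j] is what H prescribes
    ([zeta_eps_xi]).  So iota and the inverse j exist, and they are mutually
    inverse after localization because they are so on generators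
    ([trig_of_rat_localizes]).

    Injectivity of iota is a theorem of PBW type; it is proved by a faithful
    representation.  Let B be the algebra generated by the t_k and xi_i alone,
    with those relations of H that do not mention y.  Moving the y_i to the
    left shows that every element of H is a sum of terms y^a b, with b in the
    image of B ([normal_form]).  Let H act on the B-valued functions on the set
    of points p of K^n with distinct nonzero coordinates: y_i multiplies by the
    coordinate p_i, t_k permutes the coordinates and multiplies by t_k, and xi_i
    is the Dunkl operator
      m |-> xi_i m - u \sum_(k != i) (p_i - p_k)^-1 [i,k] (m - m o (i k)).
    The only relation that is not a short computation is the anticommutation of
    Dunkl operators.  There the anticommutator commutes with every y_k and kills
    the constant functions, hence kills the polynomial functions; its value at p
    depends only on the orbit of p under permutations, on which every function
    agrees with a polynomial one ([local_op_eq0]).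

    The y_i act invertibly, so the action extends to H' and an element of the
    kernel of iota acts by zero.  Applied to the constant function 1, a sum of
    terms y^a b becomes the function p |-> \sum p^a b, which vanishes only if
    all coefficients do, by Vandermonde determinants ([eval_separates]).  Hence
    the kernel is zero ([dunkl_faithful], [trig_of_rat_inj]). *)

(** * Brackets under conjugation by generators *)

Section NatBrackets.
Variables (A : pzRingType) (m : nat) (t : nat -> A).
Hypothesis sqr : forall k, (k < m)%N -> t k * t k = 1.
Hypothesis braid : forall k, (k.+1 < m)%N ->
  t k * t k.+1 * t k = t k.+1 * t k * t k.+1.
Hypothesis anti : forall i j, (i < m)%N -> (j < m)%N ->
  (i.+1 < j)%N || (j.+1 < i)%N -> t i * t j = - (t j * t i).

(** The bracket [i, i + d + 1].  Indexing the generators by natural numbers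
    makes the recursion on the length d structural. *)
Fixpoint bracket_rec (i d : nat) : A :=
  if d is d'.+1 then - (t (i + d) * bracket_rec i d' * t (i + d)) else t i.

Lemma bracket_rec_outer i d k : (i + d < m)%N -> (k < m)%N ->
  (k.+1 < i)%N || (i + d.+1 < k)%N -> t k * bracket_rec i d = - (bracket_rec i d * t k).
Proof.
elim: d => [|d IH] /= h km hk; first by apply: anti; lia.
rewrite mulrN mulNr opprK !mulrA (anti (i := k)) ?mulNr; try lia.
rewrite -(mulrA _ (t k)) IH; try lia.
by rewrite mulrN mulNr opprK -!mulrA (anti (i := k)) ?mulrN ?opprK //; lia.
Qed.

(** Only k = i + d - 1 needs the braid relation: there the two outer layers of
    the bracket are t_(k+1) t_k, and t_k can be carried across them as t_(k+1),
    which then passes the core, whose generators are all below k. *)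
Lemma bracket_rec_inner i d k : (i + d < m)%N -> (i < k)%N -> (k < i + d)%N ->
  t k * bracket_rec i d = - (bracket_rec i d * t k).
Proof.
elim: d => [|d IH] /= h ik kd; first by lia.
have [kd'|kd'] := ltnP k (i + d).
  rewrite mulrN mulNr opprK !mulrA (anti (i := k)) ?mulNr; try lia.
  rewrite -(mulrA _ (t k)) IH; try lia.
  by rewrite mulrN mulNr opprK -!mulrA (anti (i := k)) ?mulrN ?opprK //; lia.
have -> : (i + d.+1)%N = k.+1 by lia.
case: d {IH} h kd kd' => [|d] h kd kd'; first by lia.
have E : (i + d.+1)%N = k by lia.
rewrite /= E !(mulrN, mulNr) !opprK.
have -> : t k * (t k.+1 * (t k * bracket_rec i d * t k) * t k.+1) =
  (t k * t k.+1 * t k) * bracket_rec i d * (t k * t k.+1) by rewrite !mulrA.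
rewrite braid; try lia.
rewrite -(mulrA _ (t k.+1) (bracket_rec i d)) bracket_rec_outer; try lia.
rewrite mulrN mulNr; congr (- _).
by rewrite !mulrA -!(mulrA (t k.+1 * t k * bracket_rec i d)) -braid ?mulrA //; lia.
Qed.

Lemma bracket_rec_last i d : (i + d.+1 < m)%N ->
  t (i + d.+1) * bracket_rec i d.+1 = - (bracket_rec i d * t (i + d.+1)).
Proof. by move=> h /=; rewrite mulrN !mulrA sqr // mul1r. Qed.

Lemma bracket_rec_next i d : (i + d.+1 < m)%N ->
  t (i + d.+1) * bracket_rec i d = - (bracket_rec i d.+1 * t (i + d.+1)).
Proof. by move=> h /=; rewrite mulNr opprK -!mulrA sqr // mulr1. Qed.

(** The layers above i + 1 anticommute with t_i, so the induction starts at the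
    braid relation on t_i and t_(i+1). *)
Lemma bracket_rec_first i d : (i + d.+1 < m)%N ->
  t i * bracket_rec i d.+1 = - (bracket_rec i.+1 d * t i).
Proof.
elim: d => [|d IH] h.
  rewrite /= addn1 mulrN !mulrA -addn1 in h *; rewrite !addn1 in h *.
  by rewrite braid // -!mulrA sqr ?mulr1 //; lia.
have e : bracket_rec i d.+2 = - (t (i + d.+2) * bracket_rec i d.+1 * t (i + d.+2)) by [].
have e' : bracket_rec i.+1 d.+1 = - (t (i + d.+2) * bracket_rec i.+1 d * t (i + d.+2)).
  by rewrite /= addSnnS.
rewrite e e' mulrN mulNr opprK !mulrA (anti (i := i)) ?mulNr; try lia.
rewrite opprK -(mulrA _ (t i)) IH; try lia.
by rewrite mulrN mulNr -!mulrA (anti (i := i)) ?mulrN ?opprK //; lia.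
Qed.

Lemma bracket_rec_prev i d : (i.+1 + d < m)%N ->
  t i * bracket_rec i.+1 d = - (bracket_rec i d.+1 * t i).
Proof.
move=> h; have := @bracket_rec_first i d; rewrite -addSnnS => /(_ h) e.
rewrite -[bracket_rec i.+1 d]mulr1 -(@sqr i) ?mulrA; last by lia.
have e2 : bracket_rec i.+1 d * t i = - (t i * bracket_rec i d.+1) by rewrite e opprK.
by rewrite -(mulrA (t i)) e2 mulrN mulNr !mulrA sqr ?mul1r //; lia.
Qed.

Definition bracket_nat (i j : nat) : A :=
  if (i < j)%N then bracket_rec i (j - i.+1)
  else if (j < i)%N then - bracket_rec j (i - j.+1) else 0.

Definition swap_nat (k i : nat) : nat :=
  if i == k then k.+1 else if i == k.+1 then k else i.

Lemma bracket_natC i j : bracket_nat i j = - bracket_nat j i.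
Proof. by rewrite /bracket_nat; case: ltngtP; rewrite ?opprK ?oppr0. Qed.

Lemma bracket_nat_swap_lt k i j : (k < m)%N -> (i < j)%N -> (j <= m)%N ->
  t k * bracket_nat i j = - (bracket_nat (swap_nat k i) (swap_nat k j) * t k).
Proof.
move=> km ij jm; rewrite {1}/bracket_nat ij.
set d := (j - i.+1)%N; have ej : j = (i + d).+1 by rewrite /d; lia.
have [ek|k1] := eqVneq k j.
  have ek' : k = (i + d.+1)%N by lia.
  have -> : swap_nat k i = i by rewrite /swap_nat; do !case: eqP => //; lia.
  have -> : swap_nat k j = k.+1 by rewrite /swap_nat ek eqxx.
  rewrite /bracket_nat ifT; last by lia.
  have -> : (k.+1 - i.+1)%N = d.+1 by lia.
  by rewrite ek' bracket_rec_next //; lia.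
have [ek|k2] := eqVneq k.+1 i.
  have -> : swap_nat k i = k by rewrite /swap_nat; do !case: eqP => //; lia.
  have -> : swap_nat k j = j by rewrite /swap_nat; do !case: eqP => //; lia.
  rewrite /bracket_nat ifT; last by lia.
  have -> : (j - k.+1)%N = d.+1 by lia.
  by rewrite -ek bracket_rec_prev //; lia.
have [ek|k3] := eqVneq k i.
  have -> : swap_nat k i = k.+1 by rewrite /swap_nat ek eqxx.
  have [ej'|k4] := eqVneq k.+1 j.
    have -> : swap_nat k j = k by rewrite /swap_nat; do !case: eqP => //; lia.
    rewrite /bracket_nat ltnNge leqnSn /= ltnSn.
    have -> : d = 0%N by lia.
    by rewrite subnn /= ek mulNr opprK.
  have -> : swap_nat k j = j by rewrite /swap_nat; do !case: eqP => //; lia.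
  rewrite /bracket_nat ifT; last by lia.
  have -> : d = (j - k.+2).+1 by lia.
  by rewrite -ek bracket_rec_first //; lia.
have -> : swap_nat k i = i by rewrite /swap_nat; do !case: eqP => //; lia.
have [ek|k4] := eqVneq k.+1 j.
  have -> : swap_nat k j = k by rewrite /swap_nat; do !case: eqP => //; lia.
  rewrite /bracket_nat ifT; last by lia.
  have -> : d = (k - i.+1).+1 by lia.
  have -> : k = (i + (k - i.+1).+1)%N by lia.
  have -> : (i + (k - i.+1).+1 - i.+1 = k - i.+1)%N by lia.
  by rewrite bracket_rec_last //; lia.
have -> : swap_nat k j = j by rewrite /swap_nat; do !case: eqP => //; lia.
rewrite /bracket_nat ij -/d.
have [h|h] := boolP ((k.+1 < i)%N || (i + d.+1 < k)%N); first by apply: bracket_rec_outer; lia.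
by apply: bracket_rec_inner; lia.
Qed.

Lemma bracket_nat_swap k i j : (k < m)%N -> (i <= m)%N -> (j <= m)%N ->
  t k * bracket_nat i j = - (bracket_nat (swap_nat k i) (swap_nat k j) * t k).
Proof.
move=> km im jm; have [ij|ji|->] := ltngtP i j.
- exact: bracket_nat_swap_lt.
- by rewrite bracket_natC mulrN bracket_nat_swap_lt // [bracket_nat (swap_nat k i) _]bracket_natC mulNr.
- by rewrite /bracket_nat !ltnn mulr0 mul0r oppr0.
Qed.
End NatBrackets.

Section Brackets.
Variables (A : pzRingType) (n : nat) (t : 'I_n.-1 -> A).

(** The generator t_k sits between the positions k and k + 1. *)
Definition lo (k : 'I_n.-1) : 'I_n := widen_ord (leq_pred n) k.
Lemma hi_proof (k : 'I_n.-1) : (k.+1 < n)%N.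
Proof. by case: k => k /=; lia. Qed.
Definition hi (k : 'I_n.-1) : 'I_n := Ordinal (hi_proof k).
Definition adj (k : 'I_n.-1) : {perm 'I_n} := tperm (lo k) (hi k).

Definition gen_nat (k : nat) : A := oapp t 0 (insub k).

Lemma gen_natE (k : 'I_n.-1) : gen_nat k = t k.
Proof. by rewrite /gen_nat valK. Qed.

Lemma adjE (k : 'I_n.-1) (i : 'I_n) : adj k i = swap_nat k i :> nat.
Proof.
rewrite /adj /swap_nat; case: tpermP => [->|->|/eqP h1 /eqP h2] /=.
- by rewrite eqxx.
- by rewrite eqxx; case: eqP => //; lia.
- by rewrite -val_eqE /= in h1; rewrite -val_eqE /= in h2; rewrite (negbTE h1) (negbTE h2).
Qed.

Lemma bracket_ltE (i j : 'I_n) :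
  (i < j)%N -> bracket_lt t i j = bracket_rec gen_nat i (j - i.+1).
Proof.
(* Both products become products over integer intervals, whose ends can be
   peeled off. *)
have P1 a b : (b <= n.-1)%N ->
  \prod_(k <- rev (enum 'I_n.-1) | (a <= k < b)%N) t k =
  \prod_(k <- rev (index_iota a b)) gen_nat k.
  move=> bn; rewrite (eq_bigr (fun k : 'I_n.-1 => gen_nat k)) => [|k _]; last by rewrite gen_natE.
  rewrite -(big_map val (fun k => (a <= k < b)%N)) map_rev val_enum_ord.
  rewrite -big_filter filter_rev; congr (\prod_(k <- rev _) _).
  apply: (irr_sorted_eq ltn_trans ltnn) => [||k].
  - exact/sorted_filter/iota_ltn_sorted/ltn_trans.
  - exact: iota_ltn_sorted.
  - by rewrite mem_filter mem_iota mem_index_iota; lia.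
have P2 a b : (b <= n.-1)%N ->
  \prod_(k < n.-1 | (a < k < b)%N) t k = \prod_(a.+1 <= k < b) gen_nat k.
  move=> bn; rewrite (eq_bigr (fun k : 'I_n.-1 => gen_nat k)) => [|k _]; last by rewrite gen_natE.
  rewrite -(big_mkord (fun k => (a < k < b)%N)) -big_filter.
  congr (\prod_(k <- _) _); apply: (irr_sorted_eq ltn_trans ltnn) => [||k].
  - exact/sorted_filter/iota_ltn_sorted/ltn_trans.
  - exact: iota_ltn_sorted.
  - by rewrite mem_filter !mem_index_iota; lia.
have jn : (j <= n.-1)%N by case: j => j /=; lia.
move=> ij; rewrite /bracket_lt P1 // P2 //.
have -> : nat_of_ord j = ((j - i.+1) + i.+1)%N by lia.
move: (j - i.+1)%N => d {jn ij}; rewrite addnK.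
have rv a b : (a <= b)%N -> rev (index_iota a b.+1) = b :: rev (index_iota a b).
  by move=> ab; rewrite /index_iota subSn // -addn1 iotaD rev_cat /= subnKC.
elim: d => [|d IH].
  by rewrite add0n rv // /index_iota !subnn /= big_seq1 big_nil expr0 mulr1 mul1r.
rewrite addSn rv; last by lia.
rewrite big_cons big_nat_recr /=; last by lia.
have -> : (d + i.+1 = i + d.+1)%N by lia.
move: IH; have -> : (d + i.+1 = i + d.+1)%N by lia.
move=> <-; rewrite exprS mulN1r mulNr; congr (- _).
by rewrite !mulrA (commr_sign (gen_nat (i + d.+1)) d).
Qed.

Lemma bracketE (i j : 'I_n) : bracket t i j = bracket_nat gen_nat i j.
Proof. by rewrite /bracket /bracket_nat; case: ltngtP => // h; rewrite bracket_ltE. Qed.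

Lemma bracketC (i j : 'I_n) : bracket t i j = - bracket t j i.
Proof. by rewrite /bracket; case: ltngtP; rewrite ?opprK ?oppr0. Qed.

Lemma bracket_adj (k : 'I_n.-1) : bracket t (lo k) (hi k) = t k.
Proof. by rewrite bracketE /bracket_nat /= ltnSn subnn /= gen_natE. Qed.

Lemma bracket_extend (k : 'I_n.-1) (i : 'I_n) : (i < k)%N ->
  bracket t i (hi k) = - (t k * bracket t i (lo k) * t k).
Proof.
move=> ik; rewrite !bracketE /bracket_nat /= ik ifT; last by lia.
have -> : (k.+1 - i.+1 = (k - i.+1).+1)%N by lia.
by rewrite /= -gen_natE; have -> : (i + (k - i.+1).+1 = k)%N by lia.
Qed.
End Brackets.

Section BracketInd.
Variables (n : nat) (P : 'I_n -> 'I_n -> Prop).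

(** Every bracket is reached from some t_k, which is the bracket of neighbours,
    by conjugations that raise the second index by one. *)
Lemma bracket_ind :
  (forall k, P (lo k) (hi k)) ->
  (forall (i : 'I_n) (k : 'I_n.-1), (i < k)%N -> P i (lo k) -> P i (hi k)) ->
  forall i j : 'I_n, (i < j)%N -> P i j.
Proof.
move=> P1 PS i j.
move: {2}(nat_of_ord j) (leqnn j) => b; elim: b j => [|b IH] j jb ij.
  by move: ij; rewrite ltnNge (leq_trans jb).
have km : (j.-1 < n.-1)%N by case: j ij {jb} => j /=; lia.
pose k := Ordinal km; have -> : j = hi k by apply: val_inj => /=; lia.
have [->|nei] := eqVneq i (lo k); first exact: P1.
have lt_ik : (i < lo k)%N by move: nei; rewrite -val_eqE /=; lia.
by apply: PS => //; apply: IH => //=; lia.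
Qed.
End BracketInd.

Lemma tperm_hi n (i : 'I_n) (k : 'I_n.-1) : (i < k)%N ->
  tperm i (hi k) = (adj k * tperm i (lo k) * adj k)%g.
Proof.
move=> ik; have -> : (adj k * tperm i (lo k) * adj k = tperm i (lo k) ^ adj k)%g.
  by rewrite /conjg tpermV mulgA.
by rewrite tpermJ /adj tpermL tpermD // -val_eqE /=; lia.
Qed.

Section SpinAction.
Variables (A : pzRingType) (n : nat) (t : 'I_n.-1 -> A).
Hypothesis spinR : forall p q, spin_rel t p q -> p = q.

Lemma t_sqr k : t k * t k = 1.
Proof. exact/spinR/spin_sqr. Qed.

(** The bracket is an odd transposition: passing t_k applies the adjacent
    transposition to both indices and costs one sign. *)
Lemma t_bracket k i j :
  t k * bracket t i j = - (bracket t (adj k i) (adj k j) * t k).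
Proof.
have tn (l : nat) (h : (l < n.-1)%N) : gen_nat t l = t (Ordinal h).
  by rewrite -(gen_natE t (Ordinal h)).
rewrite !bracketE !adjE -gen_natE; apply: (bracket_nat_swap (m := n.-1)) => //.
- by move=> l h; rewrite !tn t_sqr.
- by move=> l h; have h' := ltnW h; rewrite (tn l h') (tn _ h); exact/spinR/spin_braid.
- by move=> a b ha hb ab; rewrite !tn; exact/spinR/spin_anti.
- by case: i => i /=; lia.
- by case: j => j /=; lia.
Qed.

(** The relations for the index k + 1 are missing from the presentations; they
    follow from those for k because t_k is an involution. *)
Lemma adj_family (e : bool) (f : 'I_n -> A) :
  (forall (k : 'I_n.-1) (i j : 'I_n), i = k :> nat -> j = k.+1 :> nat ->
     t k * f i = (-1) ^+ e * (f j * t k)) ->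
  (forall (k : 'I_n.-1) (i : 'I_n), i <> k :> nat -> i <> k.+1 :> nat ->
     t k * f i = (-1) ^+ e * (f i * t k)) ->
  forall k i, t k * f i = (-1) ^+ e * (f (adj k i) * t k).
Proof.
move=> hn hf k i; rewrite /adj; case: tpermP => [->|->|/eqP h1 /eqP h2].
- exact: hn.
- have h := hn k (lo k) (hi k) erefl erefl.
  have {}h : f (hi k) * t k = (-1) ^+ e * (t k * f (lo k)) by rewrite h signrMK.
  rewrite -[LHS]mulr1 -[X in _ * X](t_sqr k) -mulrA (mulrA (f _)) h.
  rewrite -mulrA mulrA commr_sign -!mulrA; congr (_ * _); by rewrite mulrA t_sqr mul1r.
- by apply: hf => /eqP; apply/negP; [move: h1 | move: h2]; rewrite -val_eqE.
Qed.

(** A bracket is a product of an odd number of generators, so it acts on any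
    family as a single generator does, with the same sign (-1)^e.  The index type
    is arbitrary since single indices, pairs of indices and lattice elements all
    occur. *)
Lemma bracket_act (T : Type) (act : {perm 'I_n} -> T -> T) (e : bool) (F : T -> A) :
  (forall a b v, act (a * b)%g v = act b (act a v)) ->
  (forall k v, t k * F v = (-1) ^+ e * (F (act (adj k) v) * t k)) ->
  forall i j v, i != j ->
  bracket t i j * F v = (-1) ^+ e * (F (act (tperm i j) v) * bracket t i j).
Proof.
move=> actM hF i j v ij.
wlog lt_ij : i j ij / (i < j)%N.
  move=> IH; move: (ij); rewrite -val_eqE neq_ltn => /orP[/IH|lt_ji]; first exact.
  by rewrite bracketC mulNr IH 1?eq_sym // tpermC !mulrN.
move: {ij} lt_ij v; elim/bracket_ind: i j / => [k|i k ik IH] v.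
  by rewrite bracket_adj; exact: hF.
rewrite tperm_hi //.
rewrite bracket_extend // !(mulNr, mulrN); congr (- _).
have sg x y : x * ((-1) ^+ e * y) = (-1) ^+ e * (x * y) :> A.
  by rewrite mulrA commr_sign mulrA.
rewrite -!mulrA hF sg (mulrA (bracket _ _ _)) IH.
rewrite -!mulrA !sg (mulrA (t k) (F _)) hF -!mulrA sg !signrMK.
by rewrite !actM !mulrA.
Qed.

Lemma bracket_family (f : 'I_n -> A) :
  (forall k i, t k * f i = f (adj k i) * t k) ->
  forall i j l, i != j -> bracket t i j * f l = f (tperm i j l) * bracket t i j.
Proof.
move=> hf i j l ij; rewrite (@bracket_act _ (fun w l => w l) false f) //.
- by rewrite mul1r.
- by move=> a b v; rewrite permM.
- by move=> k v; rewrite mul1r.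
Qed.

Lemma bracket_antifamily (f : 'I_n -> A) :
  (forall k i, t k * f i = - (f (adj k i) * t k)) ->
  forall i j l, i != j -> bracket t i j * f l = - (f (tperm i j l) * bracket t i j).
Proof.
move=> hf i j l ij; rewrite (@bracket_act _ (fun w l => w l) true f) //.
- by rewrite mulN1r.
- by move=> a b v; rewrite permM.
- by move=> k v; rewrite mulN1r.
Qed.

Lemma bracket_bracket i j k l : i != j ->
  bracket t i j * bracket t k l =
  - (bracket t (tperm i j k) (tperm i j l) * bracket t i j).
Proof.
move=> ij.
rewrite (@bracket_act _ (fun w p => (w p.1, w p.2)) true
  (fun p => bracket t p.1 p.2) _ _ i j (k, l)) //=.
- by rewrite mulN1r.
- by move=> a b [v w] /=; rewrite !permM.
- by move=> m [v w]; rewrite mulN1r t_bracket.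
Qed.

End SpinAction.

(** * Jucys-Murphy elements *)

Section JucysMurphy.
Variables (A : pzRingType) (n : nat) (t : 'I_n.-1 -> A).

Definition jm (i : 'I_n) : A := \sum_(k < n | (k < i)%N) bracket t k i.

Hypothesis spinR : forall p q, spin_rel t p q -> p = q.

Lemma adj_lo (k : 'I_n.-1) : adj k (lo k) = hi k. Proof. exact: tpermL. Qed.
Lemma adj_far (k : 'I_n.-1) (j : 'I_n) :
  j <> k :> nat -> j <> k.+1 :> nat -> adj k j = j.
Proof.
by move=> h1 h2; rewrite /adj tpermD // -val_eqE /=; apply/eqP => h; [apply: h1|apply: h2].
Qed.

(** The transposition at k permutes the indices below j when j is not k or k + 1. *)
Lemma jm_far (k : 'I_n.-1) (j : 'I_n) : j <> k :> nat -> j <> k.+1 :> nat ->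
  jm j * t k = - (t k * jm j).
Proof.
move=> h1 h2; rewrite /jm mulr_sumr mulr_suml -sumrN.
rewrite [RHS](reindex_inj (@perm_inj _ (adj k))) /=.
apply: eq_big => [l|l _].
  rewrite /adj; case: tpermP => [->|->|//] /=; lia.
by rewrite (t_bracket spinR) opprK tpermK adj_far.
Qed.

(** Conjugation by t_k turns all terms of N_(k+1) but [k,k+1] = t_k into those of
    N_k, up to sign; this is where the constant u in the zeta-t relation comes from. *)
Lemma jm_near k : jm (hi k) * t k + t k * jm (lo k) = 1.
Proof.
rewrite /jm (bigD1 (lo k)) //= bracket_adj mulrDl (t_sqr spinR) -addrA.
rewrite mulr_suml mulr_sumr -[RHS]addr0; congr (_ + _).
rewrite (eq_bigl (fun l : 'I_n => (l < k)%N)) => [|l]; last first.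
  by rewrite -val_eqE /=; lia.
rewrite -big_split big1 //= => l lk; rewrite (t_bracket spinR) adj_lo adj_far ?subrr //; lia.
Qed.

Lemma bracket_jm (l i j : 'I_n) : (l < i < j)%N ->
  bracket t l i * jm j = - (jm j * bracket t l i).
Proof.
move=> /andP[li ij]; rewrite /jm mulr_sumr mulr_suml -sumrN.
have nli : l != i by rewrite -val_eqE /=; lia.
rewrite [RHS](reindex_inj (@perm_inj _ (tperm l i))) /=.
apply: eq_big => [m|m _]; first by case: tpermP => [->|->|//] /=; lia.
rewrite (bracket_bracket spinR) //; congr (- (bracket t _ _ * _)).
by rewrite tpermD // -val_eqE /=; lia.
Qed.

(** The brackets in N_i only permute the indices below j. *)
Lemma jm_anticomm (i j : 'I_n) : (i < j)%N -> jm i * jm j = - (jm j * jm i).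
Proof.
move=> ij; rewrite [jm i]/jm mulr_suml [X in - X]mulr_sumr -sumrN.
by apply: eq_bigr => l li; rewrite bracket_jm ?li.
Qed.
End JucysMurphy.

(** * Laurent monomials and divided differences *)

Section Lattice.
Variable n : nat.
Notation lattice := {ffun 'I_n -> int}.

Lemma lattice_ind (P : lattice -> Prop) : P 0 ->
  (forall eta theta, P eta -> P theta -> P (eta + theta)) ->
  (forall eta, P eta -> P (- eta)) -> (forall i, P (epsilon i)) ->
  forall eta, P eta.
Proof.
move=> P0 PD PN Pe eta.
have Pm theta (p : nat) : P theta -> P (theta *+ p).
  by move=> h; elim: p => [|p IH]; rewrite ?mulr0n // mulrS; apply: PD.
have -> : eta = \sum_i epsilon i *~ eta i.
  have mzE (f : lattice) c j : (f *~ c) j = f j * c.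
    case: c => p; first by rewrite -pmulrn ffunMnE -mulr_natr natz.
    by rewrite NegzE mulrNz ffunE -pmulrn ffunMnE -mulr_natr natz mulrN.
  apply/ffunP => j; rewrite sum_ffunE (bigD1 j) //= big1 => [|i ij].
    by rewrite mzE ffunE eqxx mul1r addr0.
  by rewrite mzE ffunE eq_sym (negbTE ij) mul0r.
apply: big_ind => // i _; case: (eta i) => p; first exact: Pm.
by rewrite NegzE mulrNz; apply/PN/Pm.
Qed.
End Lattice.

Section LaurentCalculus.
Variables (A : pzRingType) (n : nat) (e e' : 'I_n -> A).
Notation lattice := {ffun 'I_n -> int}.
Hypothesis eV : forall i, e i * e' i = 1.
Hypothesis Ve : forall i, e' i * e i = 1.
Hypothesis eC : forall i j, e i * e j = e j * e i.
Notation L := (lat_exp e e').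

Let LD := lat_expD eV Ve eC.

Lemma lat_exp_eps i : L (epsilon i) = e i.
Proof.
rewrite /lat_exp (eq_bigr (fun j => if j == i then e i else 1)); last first.
  by move=> j _; rewrite ffunE; case: eqP => [->|_] //=; rewrite ?expr1 ?expr0.
rewrite -big_mkcond /= big_pred1_eq //.
Qed.

Lemma lat_expN eta : L eta * L (- eta) = 1.
Proof. by rewrite -LD subrr lat_exp0. Qed.

Lemma lat_expNl eta : L (- eta) * L eta = 1.
Proof. by rewrite -LD addNr lat_exp0. Qed.

Lemma lat_expC eta theta : L eta * L theta = L theta * L eta.
Proof. by rewrite -!LD addrC. Qed.

(** The quotient is e^eta times (1 - e^(-c alpha)) / (1 - e^alpha).  The second
    factor is a cocycle in c ([geom_quot_cocycle]), and this replaces the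
    cancellation of 1 - e^alpha, which may be a zero divisor in a general ring. *)
Lemma geom_quotE eta alpha c :
  geom_quot e e' eta alpha c = L eta * geom_quot e e' 0 alpha c.
Proof.
case: c => p /=; rewrite ?mulrN mulr_sumr; [congr (- _)|];
  by apply: eq_bigr => j _; rewrite -LD ?add0r ?sub0r.
Qed.

Lemma geom_quot1 alpha c : geom_quot e e' 0 alpha (c + 1) =
  geom_quot e e' 0 alpha c - L (- (alpha *~ (c + 1))).
Proof.
case: c => [p|[|p]].
- by rewrite -PoszD addn1 /= big_ord_recr /= opprD sub0r -pmulrn.
- by rewrite [Negz 0 + 1]/(0 : int) /= big_ord0 big_ord1 mulr0z mulr0n addr0 !oppr0 subrr.
- have -> : Negz p.+1 + 1 = Negz p by rewrite !NegzE -(addn1 p.+1) PoszD opprD subrK.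
  by rewrite [RHS]/= [in RHS]big_ord_recr NegzE mulrNz opprK -pmulrn /= add0r addrK.
Qed.

Lemma geom_quot_cocycle alpha c d : geom_quot e e' 0 alpha (c + d) =
  geom_quot e e' 0 alpha c + L (- (alpha *~ c)) * geom_quot e e' 0 alpha d.
Proof.
have step b : geom_quot e e' 0 alpha (c + b) =
    geom_quot e e' 0 alpha c + L (- (alpha *~ c)) * geom_quot e e' 0 alpha b <->
  geom_quot e e' 0 alpha (c + (b + 1)) = geom_quot e e' 0 alpha c +
    L (- (alpha *~ c)) * geom_quot e e' 0 alpha (b + 1).
  rewrite addrA !geom_quot1 mulrBr -LD -opprD -mulrzDr !addrA.
  by split=> [-> //|/addIr].
elim/int_ind: d => [|p|p].
- by rewrite addr0 /= big_ord0 oppr0 mulr0 addr0.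
- by rewrite -[in X in _ -> X]addn1 PoszD => /step.
- by move=> IH; apply/step; rewrite -addn1 PoszD opprD subrK.
Qed.

Lemma swap_coefD (k i : 'I_n) (eta theta : lattice) :
  swap_coef k i (eta + theta) = swap_coef k i eta + swap_coef k i theta.
Proof. by rewrite /swap_coef !ffunE; case: ifP => _; rewrite opprD addrACA. Qed.

(** The divided difference is a derivation twisted by the transposition. *)
Lemma swap_quotD (k i : 'I_n) (eta theta : lattice) : k != i ->
  swap_quot e e' k i (eta + theta) =
  swap_quot e e' k i eta * L (swap_lattice k i theta) + L eta * swap_quot e e' k i theta.
Proof.
move=> ki; rewrite swap_latticeE // /swap_quot swap_coefD.
rewrite [swap_coef k i eta + _]addrC !(geom_quotE (_ + _)) (geom_quotE eta) (geom_quotE theta).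
rewrite geom_quot_cocycle !LD mulrDr addrC !mulrA; congr (_ + _).
rewrite -!mulrA; congr (_ * _); rewrite mulrA -LD.
case: (swap_coef k i eta) => p /=; rewrite ?mulrN ?mulNr mulr_sumr mulr_suml;
  [congr (- _)|]; by apply: eq_bigr => j _; rewrite lat_expC.
Qed.

Lemma swap_quot0 (k i : 'I_n) : swap_quot e e' k i 0 = 0.
Proof.
rewrite /swap_quot; have -> : swap_coef k i 0 = 0 by rewrite /swap_coef !ffunE subrr; case: ifP.
by rewrite /= big_ord0 oppr0.
Qed.

Lemma swap_quot_eps (k i j : 'I_n) : k != i ->
  (-1) ^+ (k < i)%N * swap_quot e e' k i (epsilon j) =
  e (if (i < k)%N then i else k) * ((j == i)%:R - (j == k)%:R).
Proof.
move=> ki; rewrite /swap_quot /swap_coef /swap_root !ffunE ![_ == j]eq_sym.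
have := ki; rewrite -val_eqE neq_ltn => /orP[lt|lt].
  rewrite [(i < k)%N]ltnNge (ltnW lt) /= lt expr1 mulN1r.
  have [->|ji] := eqVneq j i; have [ek|jk] := eqVneq _ k.
  - by rewrite ek eqxx in ki.
  - by rewrite subr0 /= big_ord1 mulr1n opprK opprB addrC subrK lat_exp_eps subr0 mulr1.
  - by rewrite sub0r /= big_ord1 mulr0n addr0 ek lat_exp_eps sub0r mulrN1.
  - by rewrite !subrr /= big_ord0 !oppr0 !mulr0.
rewrite lt ltnNge (ltnW lt) /= mul1r.
have [->|ji] := eqVneq j i; have [ek|jk] := eqVneq _ k.
- by rewrite ek eqxx in ki.
- by rewrite sub0r subr0 /= big_ord1 mulr0n addr0 lat_exp_eps mulr1.
- by rewrite subr0 /= big_ord1 mulr1n ek opprB addrC subrK lat_exp_eps sub0r mulrN1.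
- by rewrite !subrr /= big_ord0 !oppr0 !mulr0.
Qed.

Lemma twist_lat_exp (x : A) (s : {perm 'I_n}) :
  (forall i, x * e i = e (s i) * x) ->
  forall eta : lattice, x * L eta = L [ffun j => eta ((s^-1)%g j)] * x.
Proof.
move=> hx; elim/lattice_ind => [|eta theta IH1 IH2|eta IH|i].
- by rewrite lat_exp0 mulr1 (_ : finfun _ = 0) ?lat_exp0 ?mul1r //; apply/ffunP => j; rewrite !ffunE.
- rewrite LD mulrA IH1 -mulrA IH2 mulrA -LD; congr (L _ * _).
  by apply/ffunP => j; rewrite !ffunE.
- rewrite -[LHS]mul1r -(lat_expNl [ffun j => eta ((s^-1)%g j)]) -!mulrA.
  rewrite (mulrA (L [ffun j => eta _])) -IH -mulrA lat_expN mulr1; congr (L _ * _).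
  by apply/ffunP => j; rewrite !ffunE.
- rewrite lat_exp_eps hx -lat_exp_eps; congr (L _ * _).
  by apply/ffunP => j; rewrite !ffunE (can2_eq (permKV s) (permK s)).
Qed.
End LaurentCalculus.

(** * Equivalence of the rational and trigonometric relations *)

Section ChangeOfVariables.
Variables (A : pzRingType) (n : nat) (u : A).
Variables (t : 'I_n.-1 -> A) (e e' : 'I_n -> A).
Notation lattice := {ffun 'I_n -> int}.
Notation L := (lat_exp e e').
Hypothesis uC : forall x, u * x = x * u.
Hypothesis spinR : forall p q, spin_rel t p q -> p = q.
Hypothesis eV : forall i, e i * e' i = 1.
Hypothesis Ve : forall i, e' i * e i = 1.
Hypothesis eC : forall i j, e i * e j = e j * e i.
Hypothesis te : forall k i, t k * e i = e (adj k i) * t k.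

(** In the rational relations xi_i y_j - y_j xi_i = u cross_ij.  The differences of
    Kronecker symbols treat i = j and i != j alike. *)
Definition cross (i j : 'I_n) : A :=
  \sum_(k < n | k != i) ((j == i)%:R - (j == k)%:R) * bracket t k i.

Lemma cross_diag i : cross i i = - \sum_(k < n | k != i) bracket t i k.
Proof.
rewrite /cross -sumrN; apply: eq_bigr => k ki.
by rewrite eqxx eq_sym (negbTE ki) subr0 mul1r bracketC.
Qed.

Lemma cross_off i j : j != i -> cross i j = - bracket t j i.
Proof.
move=> ji; rewrite /cross (bigD1 j) //= (negbTE ji) eqxx sub0r mulN1r.
by rewrite big1 ?addr0 // => k /andP[_ /negbTE kj]; rewrite eq_sym kj subrr mul0r.
Qed.

(** The correction by N_i removes the asymmetry between k < i and k > i in the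
    divided differences of e^(epsilon_j). *)
Lemma swap_sum_eps i j :
  \sum_(k < n | k != i) (-1) ^+ (k < i)%N * swap_quot e e' k i (epsilon j) * bracket t k i =
  e i * cross i j + (jm t i * e j - e j * jm t i).
Proof.
have -> : jm t i * e j - e j * jm t i =
    \sum_(k < n | k != i) if (k < i)%N then (e (tperm k i j) - e j) * bracket t k i else 0.
  rewrite /jm mulr_suml mulr_sumr -sumrB -big_mkcondr /=.
  apply: eq_big => [k|k ki]; first by rewrite -val_eqE /=; lia.
  rewrite mulrBl (bracket_family te) // -val_eqE /=; lia.
rewrite /cross mulr_sumr -big_split /=; apply: eq_bigr => k ki.
rewrite swap_quot_eps // mulrA; have [lt|le] := ltnP k i; last first.
  rewrite addr0; congr (e _ * _ * _); case: ifP => //.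
  by move: ki; rewrite -val_eqE /=; lia.
rewrite ltnNge (ltnW lt) /= -mulrDl; congr (_ * _).
have [->|ji] := eqVneq j i; first by rewrite eq_sym (negbTE ki) tpermR subr0 !mulr1 addrC subrK.
have [->|jk] := eqVneq j k; first by rewrite tpermL sub0r !mulrN1 addrA addNr add0r.
by rewrite tpermD 1?eq_sym // !subrr !mulr0 addr0.
Qed.

Lemma te' k i : t k * e' i = e' (adj k i) * t k.
Proof.
rewrite -[t k * e' i]mul1r -(Ve (adj k i)) -!mulrA (mulrA (e _)) -te.
by rewrite -mulrA eV mulr1.
Qed.

(** Both sides are derivations in eta, where the right factor is twisted by the
    transposition that the bracket induces; hence they agree everywhere as soon
    as they agree on the epsilon_j. *)
Lemma zeta_lat (z : A) (i : 'I_n) :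
  (forall j, z * e j - e j * z = u * \sum_(k < n | k != i)
     (-1) ^+ (k < i)%N * swap_quot e e' k i (epsilon j) * bracket t k i) ->
  forall eta, z * L eta - L eta * z = u * \sum_(k < n | k != i)
     (-1) ^+ (k < i)%N * swap_quot e e' k i eta * bracket t k i.
Proof.
move=> hz; pose S eta := \sum_(k < n | k != i)
  (-1) ^+ (k < i)%N * swap_quot e e' k i eta * bracket t k i.
have LD := lat_expD eV Ve eC.
have S0 : S 0 = 0 by rewrite /S big1 // => k _; rewrite swap_quot0 mulr0 mul0r.
have SD eta theta : S (eta + theta) = S eta * L theta + L eta * S theta.
  rewrite /S mulr_suml mulr_sumr -big_split; apply: eq_bigr => k ki /=.
  rewrite swap_quotD // mulrDr mulrDl; congr (_ + _).
    rewrite -!mulrA; congr (_ * (_ * _)).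
    rewrite (twist_lat_exp eV Ve eC (s := tperm k i)); last first.
      by move=> l; apply: (bracket_family te).
    by congr (L _ * _); apply/ffunP => j; rewrite !ffunE tpermV.
  by rewrite !mulrA commr_sign.
have comD x a b : x * (a * b) - a * b * x = (x * a - a * x) * b + a * (x * b - b * x) :> A.
  by rewrite mulrBl mulrBr !mulrA addrA subrK.
elim/lattice_ind => [|eta theta IH1 IH2|eta IH|j].
- by rewrite -/(S 0) S0 mulr0 lat_exp0 mulr1 mul1r subrr.
- by rewrite -/(S _) SD LD comD IH1 IH2 mulrDr !mulrA (uC (L eta)).
- have h : u * S eta * L (- eta) + L eta * (z * L (- eta) - L (- eta) * z) = 0.
    by rewrite -IH -comD lat_expN // mulr1 mul1r subrr.
  have h' : u * S eta * L (- eta) + L eta * (u * S (- eta)) = 0.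
    by rewrite (mulrA (L eta)) -uC -!mulrA -mulrDr -SD subrr S0 mulr0.
  rewrite -/(S _) -[LHS]mul1r -[RHS]mul1r -(lat_expNl eV Ve eC eta) -!mulrA.
  by congr (_ * _); apply: (addrI (u * S eta * L (- eta))); rewrite h h'.
- by rewrite lat_exp_eps.
Qed.

Section ThreeFamilies.
Variables x zeta xi : 'I_n -> A.
Hypothesis x_zeta : forall i, zeta i = x i + u * jm t i.
Hypothesis x_xi : forall i, x i = e i * xi i.

Lemma zeta_eps_xi i j :
  (zeta i * e j - e j * zeta i = u * \sum_(k < n | k != i)
     (-1) ^+ (k < i)%N * swap_quot e e' k i (epsilon j) * bracket t k i) <->
  xi i * e j - e j * xi i = u * cross i j.
Proof.
rewrite swap_sum_eps x_zeta mulrDl mulrDr opprD addrACA mulrDr.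
have -> : u * jm t i * e j - e j * (u * jm t i) = u * (jm t i * e j - e j * jm t i).
  by rewrite mulrBr (mulrA (e j)) -uC -!mulrA.
have -> : x i * e j - e j * x i = e i * (xi i * e j - e j * xi i).
  by rewrite x_xi mulrBr !mulrA (eC i j).
split=> [/addIr h|->]; last by rewrite !mulrA (uC (e i)).
by rewrite -[LHS]mul1r -(Ve i) -mulrA h (mulrA u) (uC (e i)) !mulrA Ve mul1r.
Qed.

Hypothesis tx : forall k i, t k * x i = - (x (adj k i) * t k).
Hypothesis xi_e : forall i j, xi i * e j - e j * xi i = u * cross i j.

Lemma t_xi k i : t k * xi i = - (xi (adj k i) * t k).
Proof.
have xiE j : xi j = e' j * x j by rewrite x_xi mulrA Ve mul1r.
by rewrite !xiE mulrA te' -!mulrA tx mulrN.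
Qed.

(** On the left the cross terms between x and N reduce to those that contain
    [i,j], and these cancel against the commutators that arise when y_j is moved
    across xi_i in x_i x_j. *)
Lemma xi_anticommP (i j : 'I_n) : (i < j)%N ->
  zeta i * zeta j + zeta j * zeta i = e i * e j * (xi i * xi j + xi j * xi i).
Proof.
move=> ij; have nij : i != j by rewrite -val_eqE /=; lia.
have xx a b : a != b -> x a * x b = e a * e b * (xi a * xi b) - u * (x a * bracket t a b).
  move=> ab; have := xi_e a b; rewrite cross_off 1?eq_sym // -bracketC.
  move=> /eqP; rewrite subr_eq => /eqP h.
  rewrite !x_xi -!mulrA (mulrA (xi a)) h mulrDl mulrDr addrC; congr (_ + _).
    by rewrite -!mulrA.
  rewrite -(mulrA u) (bracket_antifamily t_xi) // tpermR !mulrN (mulrA (e a) u).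
  by rewrite -uC -!mulrA.
have mulE a b c d : (a + u * b) * (c + u * d) =
    a * c + (u * (a * d) + u * (b * c)) + u * (u * (b * d)) :> A.
  rewrite mulrDl !mulrDr (mulrA a) -uC -!mulrA (mulrA b) -uC -!mulrA.
  by rewrite !addrA.
have -> : zeta i * zeta j + zeta j * zeta i = (x i * x j + x j * x i) +
    (u * (x i * jm t j + jm t j * x i) + u * (jm t i * x j + x j * jm t i)) +
    u * (u * (jm t i * jm t j + jm t j * jm t i)).
  rewrite !x_zeta !mulE !(mulrDr u) addrACA (addrACA (x i * x j)).
  by congr (_ + _ + _); rewrite [X in _ + X]addrC addrACA.
rewrite (jm_anticomm spinR ij) addNr !mulr0 addr0.
have jx a b : a != b -> bracket t a b * x a = - (x b * bracket t a b).
  by move=> ab; rewrite (bracket_antifamily tx) // tpermL.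
have -> : jm t i * x j + x j * jm t i = 0.
  rewrite /jm mulr_suml mulr_sumr -big_split big1 //= => k ki.
  rewrite (bracket_antifamily tx) ?tpermD ?addNr // -?val_eqE /=; lia.
have -> : x i * jm t j + jm t j * x i = x i * bracket t i j - x j * bracket t i j.
  rewrite /jm (bigD1 i) //= mulrDr mulrDl -jx // addrACA -[RHS]addr0; congr (_ + _).
  rewrite mulr_suml mulr_sumr -big_split big1 //= => k /andP[kj ki].
  by rewrite (bracket_antifamily tx) ?tpermD ?subrr // -?val_eqE /=; lia.
rewrite mulr0 addr0 (xx i j) // (xx j i) 1?eq_sym // (bracketC t j i).
rewrite !mulrN opprK mulrBr (eC j i) mulrDr (addrACA (e i * e j * _)) -addrA.
by rewrite -!addrA (addrA (- _)) (addrACA (- _)) addNr subrr !addr0.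
Qed.
End ThreeFamilies.
End ChangeOfVariables.

Section Equivalence.
Variables (A : pzRingType) (n : nat) (u : A) (t : 'I_n.-1 -> A).
Hypothesis uC : forall x, u * x = x * u.

(** Substituting zeta_i = y_i xi_i + u N_i, over any ring in which the y_i are
    invertible. *)
Lemma rat_rel_trig (xi y y' : 'I_n -> A) :
  (forall p q, rat_rel u t xi y p q -> p = q) ->
  (forall i, y i * y' i = 1) -> (forall i, y' i * y i = 1) ->
  forall p q, trig_rel u t (fun i => y i * xi i + u * jm t i) y y' p q -> p = q.
Proof.
move=> ratR yV Vy.
have spinR p q : spin_rel t p q -> p = q by move=> h; exact/ratR/rat_spin.
have yC i j : y i * y j = y j * y i.
  by have [->//|ij] := eqVneq i j; exact/ratR/rat_y_y.
have ty k i : t k * y i = y (adj k i) * t k.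
  have := @adj_family _ _ _ spinR false y _ _ k i; rewrite !mul1r; apply.
  - by move=> l a b ha hb; rewrite mul1r; exact/ratR/rat_t_y.
  - by move=> l a ha hb; rewrite mul1r; exact/ratR/rat_t_y_far.
have txi k i : t k * xi i = - (xi (adj k i) * t k).
  have := @adj_family _ _ _ spinR true xi _ _ k i; rewrite expr1 !mulN1r; apply.
  - by move=> l a b ha hb; rewrite mulN1r; exact/ratR/rat_t_xi.
  - by move=> l a ha hb; rewrite mulN1r; exact/ratR/rat_t_xi_far.
pose x i := y i * xi i.
have tx k i : t k * x i = - (x (adj k i) * t k).
  by rewrite /x mulrA ty -mulrA txi mulrN mulrA.
have xi_y i j : xi i * y j - y j * xi i = u * cross t i j.
  rewrite -opprB; have [->|ij] := eqVneq j i.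
    by rewrite (ratR _ _ (rat_y_xi_diag _ _ _ _ i)) cross_diag mulrN.
  by rewrite (ratR _ _ (rat_y_xi _ _ _ _ ij)) cross_off // mulrN.
pose zeta i := x i + u * jm t i; rewrite -/zeta.
have antic (i j : 'I_n) : (i < j)%N -> zeta i * zeta j + zeta j * zeta i = 0.
  move=> ij; rewrite (xi_anticommP uC spinR yV Vy yC ty (x := x) (xi := xi)) //.
  by rewrite (ratR _ _ (rat_xi_xi _ _ _ _ _)) ?addNr ?mulr0 // -val_eqE /=; lia.
move=> p q [{}p {}q|i|i|i j|k i j ei ej|k j h1 h2|k i j ei ej|k j h1 h2|i j ij|i eta].
- exact: spinR.
- exact: yV.
- exact: Vy.
- exact: yC.
- exact/ratR/rat_t_y.
- exact/ratR/rat_t_y_far.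
- have -> : i = lo k by apply: val_inj.
  have -> : j = hi k by apply: val_inj.
  rewrite /zeta mulrDl mulrDr addrACA tx adj_lo subrr add0r (mulrA (t k)) -uC -!mulrA.
  by rewrite -mulrDr jm_near // mulr1.
- rewrite /zeta mulrDl mulrDr tx adj_far // opprD opprK (mulrA (t k)) -uC -!mulrA.
  by rewrite jm_far // mulrN.
- apply/eqP; rewrite -addr_eq0; apply/eqP.
  move: ij; rewrite -val_eqE neq_ltn => /orP[|] /antic //=.
  by rewrite addrC.
- apply: zeta_lat => // j.
  have zx l : zeta l = x l + u * jm t l by [].
  have xx l : x l = y l * xi l by [].
  by apply: (proj2 (zeta_eps_xi uC Vy yC ty zx xx i j)); exact: xi_y.
Qed.

(** The inverse substitution xi_i = e^(- epsilon_i) (zeta_i - u N_i). *)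
Lemma trig_rel_rat (zeta e e' : 'I_n -> A) :
  (forall p q, trig_rel u t zeta e e' p q -> p = q) ->
  forall p q, rat_rel u t (fun i => e' i * (zeta i - u * jm t i)) e p q -> p = q.
Proof.
move=> trigR.
have spinR p q : spin_rel t p q -> p = q by move=> h; exact/trigR/trig_spin.
have eV i : e i * e' i = 1 by exact/trigR/trig_e_V.
have Ve i : e' i * e i = 1 by exact/trigR/trig_V_e.
have eC i j : e i * e j = e j * e i by exact/trigR/trig_e_e.
have te k i : t k * e i = e (adj k i) * t k.
  have := @adj_family _ _ _ spinR false e _ _ k i; rewrite !mul1r; apply.
  - by move=> l a b ha hb; rewrite mul1r; exact/trigR/trig_t_e.
  - by move=> l a ha hb; rewrite mul1r; exact/trigR/trig_t_e_far.
pose x i := zeta i - u * jm t i.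
have tx k i : t k * x i = - (x (adj k i) * t k).
  have := @adj_family _ _ _ spinR true x _ _ k i; rewrite expr1 !mulN1r; apply.
  - move=> l a b ha hb; have -> : a = lo l by apply: val_inj.
    have -> : b = hi l by apply: val_inj.
    have := trigR _ _ (trig_zeta_t u t zeta e e' (k := l) (i := lo l) (j := hi l) erefl erefl).
    rewrite mulN1r => h.
    have {}h : _ = _ := etrans h (esym (mulr1 u)).
    rewrite -(jm_near spinR l) mulrDr in h.
    apply/eqP; rewrite -addr_eq0 /x mulrBr mulrBl addrACA -opprD (mulrA (t l)) -uC -!mulrA.
    by rewrite [X in X - _]addrC h [X in _ - X]addrC subrr.
  - move=> l a ha hb; rewrite mulN1r /x mulrBr mulrBl.
    have h : t l * zeta a = - (zeta a * t l).
      by rewrite (trigR _ _ (trig_zeta_t_far _ _ _ _ _ ha hb)) opprK.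
    rewrite h opprB (mulrA (t l)) -uC -!mulrA -[t l * jm _ _]opprK.
    by rewrite -jm_far // mulrN opprK addrC.
pose xi i := e' i * x i; rewrite -/xi.
have x_xi i : x i = e i * xi i by rewrite /xi mulrA eV mul1r.
have x_zeta i : zeta i = x i + u * jm t i by rewrite /x subrK.
have txi := t_xi eV Ve te x_xi tx.
have xi_e i j : xi i * e j - e j * xi i = u * cross t i j.
  apply/(zeta_eps_xi uC Ve eC te x_zeta x_xi).
  by rewrite -(trigR _ _ (trig_zeta_e u t zeta e e' i (epsilon j))) lat_exp_eps.
have antic (i j : 'I_n) : (i < j)%N -> xi i * xi j + xi j * xi i = 0.
  move=> ij; have := xi_anticommP uC spinR eV Ve eC te x_zeta x_xi tx xi_e ij.
  rewrite (trigR _ _ (trig_zeta_zeta _ _ _ _ _ _)) ?addNr => [h|]; last by rewrite -val_eqE /=; lia.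
  rewrite -[LHS]mul1r -(Ve j) -mulrA -[e j * _]mul1r -(Ve i) -mulrA (mulrA (e i)) -h.
  by rewrite !mulr0.
move=> p q [{}p {}q|i j ij|i j ij|k i j ei ej|k i j ei ej|k i h1 h2|k i h1 h2|i j ij|i].
- exact: spinR.
- apply/eqP; rewrite -addr_eq0; apply/eqP.
  move: ij; rewrite -val_eqE neq_ltn => /orP[|] /antic //=.
  by rewrite addrC.
- exact: eC.
- have -> : i = lo k by apply: val_inj.
  have -> : j = hi k by apply: val_inj.
  by rewrite txi adj_lo.
- exact/trigR/trig_t_e.
- by rewrite txi adj_far.
- exact/trigR/trig_t_e_far.
- by rewrite -opprB xi_e cross_off // mulrN opprK.
- by rewrite -opprB xi_e cross_diag mulrN opprK.
Qed.
End Equivalence.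

(** * The ring of linear endomorphisms *)

Section LinearEndomorphisms.
Variables (K : comNzRingType) (V : lmodType K).

Record endo : Type := Endo { endo_fun :> V -> V; endo_linear : linear endo_fun }.

Lemma endoP (f g : endo) : (forall v, f v = g v) -> f = g.
Proof.
case: f => f hf; case: g => g hg /= fg; have efg : f = g by apply/funext.
by rewrite {f fg}efg in hf *; rewrite (Prop_irrelevance hf hg).
Qed.

HB.instance Definition _ := gen_eqMixin endo.
HB.instance Definition _ := gen_choiceMixin endo.

Lemma endoD (f : endo) v w : f (v + w) = f v + f w.
Proof. by have := endo_linear f 1 v w; rewrite !scale1r. Qed.
Lemma endo0 (f : endo) : f 0 = 0.
Proof. by apply: (addrI (f 0)); rewrite -endoD !addr0. Qed.
Lemma endoZ (f : endo) a v : f (a *: v) = a *: f v.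
Proof. by have := endo_linear f a v 0; rewrite !addr0 endo0 addr0. Qed.
Lemma endo_sum (f : endo) (I : Type) (r : seq I) (P : pred I) (F : I -> V) :
  f (\sum_(i <- r | P i) F i) = \sum_(i <- r | P i) f (F i).
Proof. exact: (big_morph f (endoD f) (endo0 f)). Qed.

Fact endo_zero_linear : linear (fun _ : V => 0 : V).
Proof. by move=> a v w; rewrite scaler0 addr0. Qed.
Fact endo_add_linear (f g : endo) : linear (fun v => f v + g v).
Proof. by move=> a v w; rewrite !endoD !endoZ scalerDr addrACA. Qed.
Fact endo_opp_linear (f : endo) : linear (fun v => - f v).
Proof. by move=> a v w; rewrite endoD endoZ opprD scalerN. Qed.
Fact endo_one_linear : linear (@id V).
Proof. by []. Qed.
Fact endo_mul_linear (f g : endo) : linear (fun v => f (g v)).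
Proof. by move=> a v w; rewrite !endoD !endoZ. Qed.

Definition endo_zero := Endo endo_zero_linear.
Definition endo_add f g := Endo (endo_add_linear f g).
Definition endo_opp f := Endo (endo_opp_linear f).
Definition endo_one := Endo endo_one_linear.
Definition endo_mul f g := Endo (endo_mul_linear f g).

Fact endo_addA : associative endo_add.
Proof. by move=> f g h; apply: endoP => v /=; rewrite addrA. Qed.
Fact endo_addC : commutative endo_add.
Proof. by move=> f g; apply: endoP => v /=; rewrite addrC. Qed.
Fact endo_add0 : left_id endo_zero endo_add.
Proof. by move=> f; apply: endoP => v /=; rewrite add0r. Qed.
Fact endo_addN : left_inverse endo_zero endo_opp endo_add.
Proof. by move=> f; apply: endoP => v /=; rewrite addNr. Qed.

HB.instance Definition _ :=
  GRing.isZmodule.Build endo endo_addA endo_addC endo_add0 endo_addN.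

Fact endo_mulA : associative endo_mul.
Proof. by move=> f g h; apply: endoP. Qed.
Fact endo_mul1 : left_id endo_one endo_mul.
Proof. by move=> f; apply: endoP. Qed.
Fact endo_mulr1 : right_id endo_one endo_mul.
Proof. by move=> f; apply: endoP. Qed.
Fact endo_mulDl : left_distributive endo_mul +%R.
Proof. by move=> f g h; apply: endoP. Qed.
Fact endo_mulDr : right_distributive endo_mul +%R.
Proof. by move=> f g h; apply: endoP => v; exact: endoD. Qed.

HB.instance Definition _ := GRing.Zmodule_isPzRing.Build endo
  endo_mulA endo_mul1 endo_mulr1 endo_mulDl endo_mulDr.

Lemma endoDE (f g : endo) v : (f + g) v = f v + g v. Proof. by []. Qed.
Lemma endoNE (f : endo) v : (- f) v = - f v. Proof. by []. Qed.
Lemma endo0E v : (0 : endo) v = 0. Proof. by []. Qed.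
Lemma endoME (f g : endo) v : (f * g) v = f (g v). Proof. by []. Qed.
Lemma endo_sumE (I : Type) (r : seq I) (P : pred I) (F : I -> endo) v :
  (\sum_(i <- r | P i) F i) v = \sum_(i <- r | P i) F i v.
Proof. exact: (big_morph (fun f : endo => f v)). Qed.

Fact endo_scal_linear a : linear (fun v : V => a *: v).
Proof. by move=> b v w; rewrite scalerDr !scalerA mulrC. Qed.
Definition endo_scal a : endo := Endo (endo_scal_linear a).

Fact endo_scal_zmod_morphism : zmod_morphism endo_scal.
Proof. by move=> a b; apply: endoP => v; exact: scalerBl. Qed.
Fact endo_scal_monoid_morphism : monoid_morphism endo_scal.
Proof.
by split=> [|a b]; apply: endoP => v; [exact: scale1r | rewrite endoME /= scalerA].
Qed.
HB.instance Definition _ :=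
  GRing.isZmodMorphism.Build K endo endo_scal endo_scal_zmod_morphism.
HB.instance Definition _ :=
  GRing.isMonoidMorphism.Build K endo endo_scal endo_scal_monoid_morphism.

Lemma endo_scalC a f : endo_scal a * f = f * endo_scal a.
Proof. by apply: endoP => v; rewrite !endoME /= endoZ. Qed.
End LinearEndomorphisms.

(** * Dunkl operators *)

Section AnticommutatorCommutes.
Variables (A : pzRingType) (n : nat) (u : A) (t : 'I_n.-1 -> A) (xi y : 'I_n -> A).
Hypothesis uC : forall x, u * x = x * u.
Hypothesis txi : forall k i, t k * xi i = - (xi (adj k i) * t k).
Hypothesis xi_y : forall i j, xi i * y j - y j * xi i = u * cross t i j.

Lemma anticomm_cross i j k : i != j -> xi i * cross t j k + cross t j k * xi i =
  ((k == j)%:R - (k == i)%:R) * ((xi i - xi j) * bracket t i j).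
Proof.
move=> ij; rewrite /cross mulr_sumr mulr_suml -big_split (bigD1 i) //=.
have cC (c : A) (b b' : bool) : c * (b%:R - b'%:R) = (b%:R - b'%:R) * c.
  by rewrite mulrBr mulrBl; case: b; case: b'; rewrite ?mulr1 ?mulr0 ?mul1r ?mul0r.
rewrite big1 ?addr0 => [|l /andP[lj li]]; last first.
  rewrite mulrA cC -!mulrA (bracket_antifamily txi) // tpermD ?mulrN ?subrr //.
  by rewrite eq_sym.
rewrite mulrA cC -!mulrA -mulrDr (bracket_antifamily txi) // tpermL.
by rewrite mulrBl.
Qed.

(** By the Leibniz rule the commutator is u times the sum of the two
    anticommutators of xi_i with cross_jk and of xi_j with cross_ik, and these
    are opposite to each other. *)
Lemma anticomm_comm_y i j k : i != j ->
  GRing.comm (xi i * xi j + xi j * xi i) (y k).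
Proof.
move=> ij; apply/eqP; rewrite -subr_eq0.
have h a b : xi a * xi b * y k - y k * (xi a * xi b) =
    u * (xi a * cross t b k + cross t a k * xi b).
  rewrite mulrDr (mulrA u (xi a)) uC -!mulrA -xi_y (mulrA u) -xi_y.
  by rewrite mulrBr mulrBl !mulrA addrA subrK.
rewrite mulrDl mulrDr opprD addrACA !h -mulrDr addrACA addrC.
rewrite [cross _ _ _ * _ + _]addrC addrACA.
rewrite [X in X + _]addrC anticomm_cross // [X in _ + X]addrC anticomm_cross 1?eq_sym //.
rewrite (bracketC t j i) -(opprB (xi i)) -(opprB (k == j)%:R).
by rewrite mulrNN mulNr subrr mulr0.
Qed.
End AnticommutatorCommutes.

(** The relations of the rational algebra among the odd generators alone. *)
Section OddPart.
Variables (A : pzRingType) (n : nat) (t : 'I_n.-1 -> A) (xi : 'I_n -> A).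
Inductive odd_rel : A -> A -> Prop :=
| odd_spin p q : spin_rel t p q -> odd_rel p q
| odd_xi_xi i j : i != j -> odd_rel (xi i * xi j) (- (xi j * xi i))
| odd_t_xi (k : 'I_n.-1) (i j : 'I_n) : i = k :> nat -> j = k.+1 :> nat ->
    odd_rel (t k * xi i) (- (xi j * t k))
| odd_t_xi_far (k : 'I_n.-1) (i : 'I_n) : i <> k :> nat -> i <> k.+1 :> nat ->
    odd_rel (t k * xi i) (- (xi i * t k)).
End OddPart.

Section RegularPoints.
Variables (K : fieldType) (n : nat).

(** Distinct coordinates make the coefficients of the Dunkl operators defined,
    nonzero ones make the y_i invertible. *)
Record regular_point : Type := RegularPoint {
  point_coord :> 'I_n -> K;
  point_coord_inj : injective point_coord;
  point_coord_neq0 : forall i, point_coord i != 0 }.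

Lemma regular_pointP (p q : regular_point) : (forall i, p i = q i) -> p = q.
Proof.
case: p => p ip np; case: q => q iq nq /= pq; have e : p = q by apply/funext.
by rewrite {p pq}e in ip np *; rewrite (Prop_irrelevance ip iq) (Prop_irrelevance np nq).
Qed.

Fact permute_inj (p : regular_point) (w : {perm 'I_n}) : injective (fun i => p (w i)).
Proof. exact: inj_comp (@point_coord_inj p) perm_inj. Qed.
Fact permute_neq0 (p : regular_point) (w : {perm 'I_n}) i : p (w i) != 0.
Proof. exact: point_coord_neq0. Qed.

Definition permute (p : regular_point) (w : {perm 'I_n}) : regular_point :=
  RegularPoint (permute_inj (p := p) (w := w)) (permute_neq0 p w).

Lemma permute1 p : permute p 1 = p.
Proof. by apply: regular_pointP => i /=; rewrite perm1. Qed.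
Lemma permuteM p w v : permute (permute p w) v = permute p (v * w)%g.
Proof. by apply: regular_pointP => i /=; rewrite permM. Qed.
End RegularPoints.

Section DunklRepresentation.
Variables (K : fieldType) (n : nat) (u : K).
Variables (G : choiceType) (rel : freeAlg K G -> freeAlg K G -> Prop).
Notation B := (presented rel).
Variables (t : 'I_n.-1 -> B) (xi : 'I_n -> B).
Hypothesis oddR : forall p q, odd_rel t xi p q -> p = q.
Notation point := (regular_point K n).
Notation M := (point -> B).
Notation E := (endo M).

Fact mult_linear (b : B) : linear ((fun m p => b * m p) : M -> M).
Proof.
move=> a m m'; apply/funext => p.
by rewrite [LHS]mulrDr -[X in X + _]pres_scalerAr.
Qed.
Definition mult b : E := Endo (mult_linear b).

Fact dilate_linear (f : point -> K) : linear ((fun m p => f p *: m p) : M -> M).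
Proof.
by move=> a m m'; apply/funext => p; rewrite [LHS]scalerDr !scalerA mulrC -scalerA.
Qed.
Definition dilate f : E := Endo (dilate_linear f).

Fact shift_linear (w : {perm 'I_n}) : linear ((fun m p => m (permute p w)) : M -> M).
Proof. by []. Qed.
Definition shift w : E := Endo (shift_linear w).

Fact dunkl_linear (i : 'I_n) : linear ((fun m p => xi i * m p - u *:
  \sum_(k < n | k != i) (p i - p k)^-1 *:
    (bracket t i k * (m p - m (permute p (tperm i k))))) : M -> M).
Proof.
move=> a m m'; apply/funext => p; rewrite !fctE.
rewrite mulrDr -pres_scalerAr scalerBr addrACA; congr (_ + _).
rewrite -opprD (scalerA a u) (mulrC a) -(scalerA u) -scalerDr.
congr (- (_ *: _)); rewrite scaler_sumr -big_split.
apply: eq_bigr => k ki /=; rewrite (scalerA a) (mulrC a) -(scalerA _ a) -scalerDr.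
by rewrite (pres_scalerAr a) -mulrDr scalerBr opprD addrACA.
Qed.
Definition dunkl i : E := Endo (dunkl_linear i).

Definition dunkl_t (k : 'I_n.-1) : E := mult (t k) * shift (adj k).
Definition dunkl_y (i : 'I_n) : E := dilate (fun p => p i).
Definition dunkl_yV (i : 'I_n) : E := dilate (fun p => (p i)^-1).
Definition constfun (b : B) : M := fun _ => b.

Lemma dunkl_yK i : dunkl_y i * dunkl_yV i = 1.
Proof.
apply: endoP => m; apply/funext => p.
by rewrite endoME /= scalerA divff ?scale1r // point_coord_neq0.
Qed.
Lemma dunkl_yVK i : dunkl_yV i * dunkl_y i = 1.
Proof.
apply: endoP => m; apply/funext => p.
by rewrite endoME /= scalerA mulVf ?scale1r // point_coord_neq0.
Qed.

Lemma dunkl_spin p q : spin_rel dunkl_t p q -> p = q.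
Proof.
have spinR a b (h : spin_rel t a b) : a = b by exact/oddR/odd_spin.
case=> [i|i j ij|i j ij]; apply: endoP => m; apply/funext => x;
  rewrite ?endoNE ?fctE !endoME /= ?mulrA ?permuteM.
- by rewrite (spinR _ _ (spin_sqr t i)) mul1r tperm2 permute1.
- rewrite (spinR _ _ (spin_braid t ij)); congr (_ * m (permute x _)).
  rewrite /adj; have -> : lo j = hi i by apply: val_inj.
  have l1 : lo i != hi i by rewrite -val_eqE /=; lia.
  have l2 : lo i != hi j by rewrite -val_eqE /=; lia.
  have l3 : hi i != hi j by rewrite -val_eqE /=; lia.
  rewrite -{1}(tpermV (lo i)) -mulgA -[((tperm _ _)^-1 * _)%g]/(_ ^ _)%g tpermJ tpermR tpermD //.
  rewrite -{1}(tpermV (hi i)) -mulgA -[((tperm _ _)^-1 * _)%g]/(_ ^ _)%g tpermJ tpermL tpermD 1?eq_sym //.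
- rewrite (spinR _ _ (spin_anti t ij)) mulNr; congr (- (_ * m (permute x _))).
  have e : (adj j ^ adj i = adj j)%g.
    by rewrite [in LHS]/adj tpermJ !tpermD // -val_eqE /=; lia.
  by rewrite -[in LHS]e /conjg tpermV -!mulgA tperm2 mulg1.
Qed.

Lemma bracket_dunkl i j : i != j ->
  bracket dunkl_t i j = mult (bracket t i j) * shift (tperm i j).
Proof.
have H (a b : 'I_n) : (a < b)%N -> bracket dunkl_t a b = mult (bracket t a b) * shift (tperm a b).
  elim/bracket_ind: a b / => [k|a k ak IH].
    by rewrite !bracket_adj.
  rewrite !bracket_extend // IH; apply: endoP => m; apply/funext => p.
  rewrite endoNE fctE !endoME /= !permuteM mulNr !mulrA; congr (- (_ * m (permute p _))).
  by rewrite tperm_hi.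
move=> ij; move: (ij); rewrite -val_eqE neq_ltn => /orP[/H //|/H h].
rewrite bracketC h tpermC [in RHS]bracketC; apply: endoP => m; apply/funext => p.
by rewrite endoNE fctE !endoME /= mulNr.
Qed.

Lemma dunkl_ty k i : dunkl_t k * dunkl_y i = dunkl_y (adj k i) * dunkl_t k.
Proof.
by apply: endoP => m; apply/funext => p; rewrite !endoME /= -pres_scalerAr.
Qed.

Lemma odd_spinR p q : spin_rel t p q -> p = q.
Proof. by move=> h; exact/oddR/odd_spin. Qed.

Lemma odd_txi k i : t k * xi i = - (xi (adj k i) * t k).
Proof.
have := @adj_family _ _ _ odd_spinR true xi _ _ k i; rewrite expr1 !mulN1r; apply.
- by move=> l a b ha hb; rewrite mulN1r; exact/oddR/odd_t_xi.
- by move=> l a ha hb; rewrite mulN1r; exact/oddR/odd_t_xi_far.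
Qed.

Lemma dunkl_txi k i : dunkl_t k * dunkl i = - (dunkl (adj k i) * dunkl_t k).
Proof.
apply: endoP => m; apply/funext => p; rewrite endoNE fctE !endoME /=.
rewrite mulrBr -pres_scalerAr (mulrA (t k) (xi i)) odd_txi mulNr -mulrA opprB [RHS]addrC.
congr (_ + _); rewrite -scalerN; congr (_ *: _).
rewrite mulr_sumr (reindex_inj (@perm_inj _ (adj k))) -sumrN /=.
apply: eq_big => [l|l li]; first by rewrite (can2_eq (tpermK _ _) (tpermK _ _)).
rewrite !tpermK -pres_scalerAr -scalerN; congr (_ *: _).
rewrite !mulrA (t_bracket odd_spinR) tpermK mulNr -mulrA mulrBr opprK; congr (_ * (_ - _ * m _)).
rewrite !permuteM; congr (permute p _).
have -> : (tperm i (adj k l) * adj k = adj k * (tperm i (adj k l) ^ adj k))%g.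
  by rewrite /conjg mulgA mulgV mul1g.
by rewrite tpermJ tpermK.
Qed.

(** In the commutator the terms with m(p) cancel.  What remains has the factor
    (p_i - p_k)^-1 (p_(s j) - p_j) with s = (i k), which is -1, 1 or 0. *)
Lemma dunkl_xi_y i j :
  dunkl i * dunkl_y j - dunkl_y j * dunkl i = endo_scal M u * cross dunkl_t i j.
Proof.
apply: endoP => m; apply/funext => p; rewrite endoDE endoNE !fctE !endoME /=.
rewrite /cross endo_sumE fct_sumE.
rewrite scalerBr pres_scalerAr opprD opprK addrACA subrr add0r addrC.
rewrite scalerA (mulrC (p j)) -scalerA -scalerBr scaler_sumr -sumrB.
congr (_ *: _); apply: eq_bigr => k ki; rewrite bracket_dunkl //.
have cE (b b' : bool) (f : E) : ((b%:R - b'%:R) * f) m p = (b%:R - b'%:R) *: f m p.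
  by case: b; case: b'; rewrite ?subrr ?subr0 ?sub0r ?mul1r ?mulN1r ?mul0r
    ?scale1r ?scaleN1r ?scale0r.
rewrite cE endoME /= (tpermC k) (bracketC t k) mulNr.
rewrite scalerA (mulrC (p j)) -scalerA -scalerBr (pres_scalerAr (p j)) -mulrBr.
have -> : p j *: (m p - m (permute p (tperm i k))) -
    (p j *: m p - p (tperm i k j) *: m (permute p (tperm i k))) =
    (p (tperm i k j) - p j) *: m (permute p (tperm i k)).
  by rewrite scalerBr opprB addrC addrA subrK scalerBl.
rewrite -pres_scalerAr scalerA scalerN -scaleNr.
congr (_ *: _).
have neq : p i - p k != 0.
  by rewrite subr_eq0; apply: contra_neq ki => /point_coord_inj.
have [->|ji] := eqVneq j i.
  by rewrite tpermL eq_sym (negbTE ki) subr0 -(opprB (p i)) mulrN mulVf.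
have [->|jk] := eqVneq j k; first by rewrite tpermR sub0r opprK mulVf.
by rewrite tpermD 1?eq_sym // !subrr mulr0 oppr0.
Qed.

(** Q m at p depends only on the restriction of m to the orbit of p. *)
Definition local_op (Q : E) : Prop := forall m m' (p : point),
  (forall w, m (permute p w) = m' (permute p w)) -> Q m p = Q m' p.

Lemma dunkl_local i : local_op (dunkl i).
Proof.
move=> m m' p h /=; have h1 : m p = m' p by rewrite -[p]permute1.
by rewrite h1; congr (_ - _ *: _); apply: eq_bigr => k _; rewrite h.
Qed.

Lemma local_opM Q Q' : local_op Q -> local_op Q' -> local_op (Q * Q').
Proof.
by move=> hQ hQ' m m' p h; apply: hQ => w; apply: hQ' => v; rewrite !permuteM h.
Qed.

Lemma local_opD Q Q' : local_op Q -> local_op Q' -> local_op (Q + Q').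
Proof. by move=> hQ hQ' m m' p h; rewrite !endoDE !fctE (hQ _ _ _ h) (hQ' _ _ _ h). Qed.

Lemma dunkl_constant i b : dunkl i (constfun b) = constfun (xi i * b).
Proof.
apply/funext => p; rewrite /= big1 ?scaler0 ?subr0 // => k _.
by rewrite subrr mulr0 scaler0.
Qed.

(** On the orbit of p, which consists of n! distinct points, m agrees with the
    Lagrange interpolation \sum_w f_w m(p w), where f_w is a polynomial in the
    coordinates.  As Q commutes with the y_k, it commutes with multiplication by
    f_w, so Q of the interpolation vanishes with Q of the constants. *)
Lemma local_op_eq0 (Q : E) : local_op Q -> (forall k, GRing.comm Q (dunkl_y k)) ->
  (forall b, Q (constfun b) = 0) -> Q = 0.
Proof.
move=> Qloc Qy Q0; apply: endoP => m; apply/funext => p; rewrite endo0E.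
have Qcomm (f : point -> K) : GRing.comm Q (dilate f) -> forall b, Q (dilate f (constfun b)) = 0.
  by move=> h b; rewrite -endoME h endoME Q0 endo0.
(* For w != v, an affine function of one coordinate, 1 at p w and 0 at p v. *)
pose sep (w v : {perm 'I_n}) (q : point) : K :=
  if [pick k | w k != v k] is Some k
  then (q k - p (v k)) / (p (w k) - p (v k)) else 1.
pose f w (q : point) := \prod_(v : {perm 'I_n} | v != w) sep w v q.
have sepC w v : GRing.comm Q (dilate (sep w v)).
  rewrite /sep; case: pickP => [k _|_].
    have -> : dilate (fun q => (q k - p (v k)) / (p (w k) - p (v k))) =
        endo_scal M (p (w k) - p (v k))^-1 * (dunkl_y k - endo_scal M (p (v k))).
      apply: endoP => m1; apply/funext => q.
      rewrite endoME endoDE endoNE !fctE /= !fctE /=.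
      by rewrite mulrC -scalerA scalerBl.
    apply: commrM; first by rewrite /GRing.comm endo_scalC.
    by apply: commrB => //; rewrite /GRing.comm endo_scalC.
  rewrite (_ : dilate _ = 1); first exact: commr1.
  by apply: endoP => m1; apply/funext => q; rewrite /= scale1r.
have fC w : GRing.comm Q (dilate (f w)).
  rewrite (_ : dilate (f w) = \prod_(v : {perm 'I_n} | v != w) dilate (sep w v)).
    by apply: commr_prod.
  rewrite /f; elim: (index_enum _) => [|v r IH].
    by rewrite big_nil; apply: endoP => m1; apply/funext => q; rewrite /= big_nil scale1r.
  rewrite big_cons -IH; apply: endoP => m1; apply/funext => q; rewrite /= big_cons.
  by case: ifP => _ //; rewrite endoME /= scalerA.
have sepE w v k : w k != v k -> p (w k) - p (v k) != 0.
  by apply: contra_neq => /eqP; rewrite subr_eq0 => /eqP /point_coord_inj.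
have fE w v : f w (permute p v) = (v == w)%:R.
  have [->|vw] := eqVneq v w.
    rewrite /f big1 // => v' _; rewrite /sep; case: pickP => //= k hk.
    by rewrite divff // sepE.
  rewrite /f (bigD1 v) //= /sep; case: pickP => [k _|h].
    by rewrite /= subrr !mul0r.
  case/eqP: vw; apply/permP => k; apply/eqP; rewrite eq_sym.
  by move/negbT: (h k); rewrite negbK.
pose m' := \sum_(w : {perm 'I_n}) dilate (f w) (constfun (m (permute p w))).
have -> : Q m p = Q m' p.
  apply: Qloc => v; rewrite /m' fct_sumE (bigD1 v) //= fE eqxx scale1r.
  by rewrite big1 ?addr0 // => w wv; rewrite fE eq_sym (negbTE wv) scale0r.
by rewrite /m' endo_sum big1 // => w _; rewrite Qcomm.
Qed.

Lemma dunkl_anticomm i j : i != j -> dunkl i * dunkl j = - (dunkl j * dunkl i).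
Proof.
move=> ij; apply/eqP; rewrite -addr_eq0; apply/eqP.
apply: local_op_eq0 => [|k|b].
- by apply: local_opD; apply: local_opM; exact: dunkl_local.
- by apply: (anticomm_comm_y (@endo_scalC _ M u) dunkl_txi dunkl_xi_y).
- rewrite endoDE !endoME !dunkl_constant; apply/funext => p.
  by rewrite !fctE /constfun !mulrA (oddR (odd_xi_xi t xi ij)) mulNr addNr.
Qed.

Lemma dunkl_rat p q : rat_rel (endo_scal M u) dunkl_t dunkl dunkl_y p q -> p = q.
Proof.
case=> [{}p {}q|i j ij|i j ij|k i j ei ej|k i j ei ej|k i h1 h2|k i h1 h2|i j ij|i].
- exact: dunkl_spin.
- exact: dunkl_anticomm.
- by apply: endoP => m; apply/funext => x; rewrite !endoME /= !scalerA mulrC.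
- have -> : i = lo k by apply: val_inj.
  have -> : j = hi k by apply: val_inj.
  by rewrite dunkl_txi adj_lo.
- have -> : i = lo k by apply: val_inj.
  have -> : j = hi k by apply: val_inj.
  by rewrite dunkl_ty adj_lo.
- by rewrite dunkl_txi adj_far.
- by rewrite dunkl_ty adj_far.
- by rewrite -opprB dunkl_xi_y cross_off // mulrN opprK.
- by rewrite -opprB dunkl_xi_y cross_diag mulrN opprK.
Qed.
End DunklRepresentation.

(** * Separation of monomials by regular points *)

Section Separation.

Lemma vandermonde_dual (K : fieldType) (N : nat) (z : 'I_N -> K) : injective z ->
  exists dual : 'I_N -> 'I_N -> K,
    forall a c : 'I_N, \sum_m dual a m * z m ^+ c = (a == c)%:R.
Proof.
move=> zI; pose V : 'M[K]_N := Vandermonde N (\row_m z m).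
have VU : V \in unitmx.
  rewrite unitmxE unitfE det_Vandermonde; apply/prodf_neq0 => i _.
  apply/prodf_neq0 => j ij; rewrite !mxE subr_eq0 (inj_eq zI) -val_eqE /=.
  by move: ij; lia.
exists (fun a m => invmx V m a) => a c.
have := congr1 (fun W : 'M_N => W c a) (mulmxV VU).
rewrite !mxE eq_sym => <-; apply: eq_bigr => m _.
by rewrite !mxE mulrC.
Qed.

Variables (K : numFieldType) (n : nat) (V : lmodType K).

(** A polynomial with coefficients in a vector space is determined by its values
    on the regular points.  The grid z_0(m_0), ..., z_(n-1)(m_(n-1)) with
    z_i(m) = n m + i + 1 consists of regular points, as its coordinates have
    different residues modulo n; products of rows of inverse Vandermonde matrices
    extract each coefficient from the values on it. *)
Lemma eval_separates (s : seq ({ffun 'I_n -> nat} * V)) :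
  (forall p : regular_point K n,
     \sum_(ab <- s) (\prod_i p i ^+ ab.1 i) *: ab.2 = 0) ->
  forall c, \sum_(ab <- s | ab.1 == c) ab.2 = 0.
Proof.
move=> s0 c.
have [N cN sN] : exists2 N, forall i, (c i < N)%N &
    forall ab, ab \in s -> forall i, (ab.1 i < N)%N.
  exists (maxn (\max_i c i) (\max_(ab <- s) \max_i ab.1 i)).+1 => [i|ab abs i].
    by rewrite ltnS leq_max leq_bigmax.
  rewrite ltnS leq_max; apply/orP; right.
  apply: leq_trans (leq_bigmax_seq _ abs _) => //; exact: (leq_bigmax (F := ab.1) i).
pose z (i : 'I_n) (m : 'I_N) : K := (n * m + i).+1%:R.
have zI i m j l : z i m = z j l -> i = j /\ m = l.
  move=> /eqP; rewrite eqr_nat eqSS => /eqP e.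
  have n0 : (0 < n)%N by case: i {e} => i /=; lia.
  have eij : i = j :> nat.
    by have := congr1 (modn^~ n) e; rewrite /= !(mulnC n) !modnMDl !modn_small.
  split; apply: val_inj => //=; move: e; rewrite eij => /addIn /eqP.
  by rewrite eqn_pmul2l // => /eqP.
have /choice[dual dualE] : forall i : 'I_n, exists dual : 'I_N -> 'I_N -> K,
    forall a d : 'I_N, \sum_m dual a m * z i m ^+ d = (a == d)%:R.
  by move=> i; apply: vandermonde_dual => m l /zI[].
have ptI (q : {ffun 'I_n -> 'I_N}) : injective (fun i => z i (q i)) by move=> i j /zI[].
have pt0 (q : {ffun 'I_n -> 'I_N}) i : z i (q i) != 0 by rewrite pnatr_eq0.
pose pt q := RegularPoint (ptI q) (pt0 q).
pose cc i : 'I_N := Ordinal (cN i).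
have key ab : ab \in s ->
    \sum_(q : {ffun 'I_n -> 'I_N}) (\prod_i dual i (cc i) (q i)) * (\prod_i pt q i ^+ ab.1 i)
    = (ab.1 == c)%:R.
  move=> abs; pose aa i : 'I_N := Ordinal (sN ab abs i).
  under eq_bigr do rewrite -big_split /=.
  rewrite -(bigA_distr_bigA (fun i m => dual i (cc i) m * z i m ^+ ab.1 i)) /=.
  under eq_bigr => i _ do rewrite (dualE i (cc i) (aa i)).
  have [e|ne] := eqVneq ab.1 c.
    by rewrite big1 // => i _; rewrite (_ : cc i = aa i) ?eqxx //; apply: val_inj; rewrite /= e.
  have [i hi] : exists i, cc i != aa i.
    apply/existsP; rewrite -negb_forall; apply: contra ne => /forallP h.
    by apply/eqP/ffunP => i; have /eqP/(congr1 val) := h i.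
  by rewrite (bigD1 i) //= (negbTE hi) mul0r.
transitivity (\sum_(ab <- s) (ab.1 == c)%:R *: ab.2).
  by rewrite big_mkcond; apply: eq_bigr => ab _; case: eqP; rewrite ?scale1r ?scale0r.
rewrite big_seq; under eq_bigr => ab abs do rewrite -key // scaler_suml.
rewrite -big_seq exchange_big big1 //= => q _.
under eq_bigr => ab _ do rewrite -scalerA.
by have := s0 (pt q); rewrite -scaler_sumr /= => ->; rewrite scaler0.
Qed.
End Separation.

(** * Transport of relations along ring homomorphisms *)

Section Transfer.
Variables (A A' C : pzRingType) (n : nat).
(** Two homomorphisms into C that agree on the generators.  With f the identity
    this shows that the generators of a presented algebra satisfy its relations;
    with g the identity, that images satisfying the relations define a map. *)
Variables (f : {rmorphism A -> C}) (g : {rmorphism A' -> C}).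

Lemma rmorph_bracket (t : 'I_n.-1 -> A) (t' : 'I_n.-1 -> A') :
  (forall k, f (t k) = g (t' k)) ->
  forall i j, f (bracket t i j) = g (bracket t' i j).
Proof.
move=> ft i j; have ltE (a b : 'I_n) : f (bracket_lt t a b) = g (bracket_lt t' a b).
  rewrite /bracket_lt !rmorphM !rmorph_sign !rmorph_prod.
  by congr (_ * (_ * _)); apply: eq_bigr => k _; exact: ft.
rewrite /bracket; case: ifP => _ //; case: ifP => _; rewrite ?rmorphN ?ltE //.
by rewrite !rmorph0.
Qed.

Variables (t : 'I_n.-1 -> A) (t' : 'I_n.-1 -> A').
Hypothesis ft : forall k, f (t k) = g (t' k).

Lemma spin_transfer : (forall p q, spin_rel t' p q -> g p = g q) ->
  forall p q, spin_rel t p q -> f p = f q.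
Proof.
apply: (spin_rel_transfer (f := f) (g := g)) => //;
  by [exact: rmorphism_monoidP | exact: rmorphN].
Qed.

Variables (xi : 'I_n -> A) (xi' : 'I_n -> A').
Hypothesis fxi : forall k, f (xi k) = g (xi' k).

Lemma odd_transfer : (forall p q, odd_rel t' xi' p q -> g p = g q) ->
  forall p q, odd_rel t xi p q -> f p = f q.
Proof.
move=> gR p q [{}p {}q|i j ij|k i j ei ej|k i h1 h2].
- by apply: spin_transfer => a b h; exact/gR/odd_spin.
- by have := gR _ _ (odd_xi_xi t' xi' ij); rewrite !(rmorphN, rmorphM) /= !(ft, fxi).
- by have := gR _ _ (odd_t_xi t' xi' ei ej); rewrite !(rmorphN, rmorphM) /= !(ft, fxi).
- by have := gR _ _ (odd_t_xi_far t' xi' h1 h2); rewrite !(rmorphN, rmorphM) /= !(ft, fxi).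
Qed.

Variables (u : A) (u' : A').
Hypothesis fu : f u = g u'.
Variables (y : 'I_n -> A) (y' : 'I_n -> A').
Hypothesis fy : forall k, f (y k) = g (y' k).
Let fb := rmorph_bracket ft.

Lemma rat_transfer : (forall p q, rat_rel u' t' xi' y' p q -> g p = g q) ->
  forall p q, rat_rel u t xi y p q -> f p = f q.
Proof.
move=> gR p q [{}p {}q|i j ij|i j ij|k i j ei ej|k i j ei ej|k i h1 h2|k i h1 h2|i j ij|i].
- by apply: spin_transfer => a b h; exact/gR/rat_spin.
- by have := gR _ _ (rat_xi_xi u' t' xi' y' ij); rewrite !(rmorphN, rmorphM) /= !fxi.
- by have := gR _ _ (rat_y_y u' t' xi' y' ij); rewrite !rmorphM /= !fy.
- by have := gR _ _ (rat_t_xi u' t' xi' y' ei ej); rewrite !(rmorphN, rmorphM) /= !(ft, fxi).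
- by have := gR _ _ (rat_t_y u' t' xi' y' ei ej); rewrite !rmorphM /= !(ft, fy).
- by have := gR _ _ (rat_t_xi_far u' t' xi' y' h1 h2); rewrite !(rmorphN, rmorphM) /= !(ft, fxi).
- by have := gR _ _ (rat_t_y_far u' t' xi' y' h1 h2); rewrite !rmorphM /= !(ft, fy).
- by have := gR _ _ (rat_y_xi u' t' xi' y' ij); rewrite !rmorphB !rmorphM /= !(fxi, fy, fb, fu).
- have := gR _ _ (rat_y_xi_diag u' t' xi' y' i).
  rewrite !rmorphB !rmorphM /= !rmorph_sum /= !(fxi, fy, fu) => ->.
  by congr (_ * _); apply: eq_bigr => k _; rewrite fb.
Qed.

Variables (e e_ : 'I_n -> A) (e' e'_ : 'I_n -> A').
Hypothesis fe : forall k, f (e k) = g (e' k).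
Hypothesis fe_ : forall k, f (e_ k) = g (e'_ k).

Lemma rmorph_lat_exp eta : f (lat_exp e e_ eta) = g (lat_exp e' e'_ eta).
Proof.
rewrite /lat_exp !rmorph_prod; apply: eq_bigr => i _.
by case: (eta i) => p /=; rewrite !rmorphXn /= ?fe ?fe_.
Qed.

Lemma rmorph_swap_quot k i eta : f (swap_quot e e_ k i eta) = g (swap_quot e' e'_ k i eta).
Proof.
rewrite /swap_quot; case: (swap_coef k i eta) => p /=; rewrite ?rmorphN !rmorph_sum /=;
  [congr (- _)|]; by apply: eq_bigr => l _; exact: rmorph_lat_exp.
Qed.

Lemma trig_transfer : (forall p q, trig_rel u' t' xi' e' e'_ p q -> g p = g q) ->
  forall p q, trig_rel u t xi e e_ p q -> f p = f q.
Proof.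
move=> gR p q [{}p {}q|i|i|i j|k i j ei ej|k j h1 h2|k i j ei ej|k j h1 h2|i j ij|i eta].
- by apply: spin_transfer => a b h; exact/gR/trig_spin.
- by have := gR _ _ (trig_e_V u' t' xi' e' e'_ i); rewrite !rmorphM /= fe fe_ !rmorph1.
- by have := gR _ _ (trig_V_e u' t' xi' e' e'_ i); rewrite !rmorphM /= fe fe_ !rmorph1.
- by have := gR _ _ (trig_e_e u' t' xi' e' e'_ i j); rewrite !rmorphM /= !fe.
- by have := gR _ _ (trig_t_e u' t' xi' e' e'_ ei ej); rewrite !rmorphM /= !fe ft.
- by have := gR _ _ (trig_t_e_far u' t' xi' e' e'_ h1 h2); rewrite !rmorphM /= !fe ft.
- by have := gR _ _ (trig_zeta_t u' t' xi' e' e'_ ei ej);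
    rewrite !rmorphD !rmorphM /= !fxi ft fu.
- by have := gR _ _ (trig_zeta_t_far u' t' xi' e' e'_ h1 h2);
    rewrite !rmorphN !rmorphM /= !fxi ft.
- by have := gR _ _ (trig_zeta_zeta u' t' xi' e' e'_ ij); rewrite !rmorphN !rmorphM /= !fxi.
- have := gR _ _ (trig_zeta_e u' t' xi' e' e'_ i eta).
  rewrite !rmorphB !rmorphM /= !rmorph_sum /= !(fxi, rmorph_lat_exp, fu) => ->.
  congr (_ * _); apply: eq_bigr => k _.
  by rewrite !rmorphM !rmorph_sign /= fb rmorph_swap_quot.
Qed.
End Transfer.

Section Presentations.
Variables (K : comNzRingType) (n : nat) (u : K).

Definition odd_pres : freeAlg K ('I_n.-1 + 'I_n)%type -> freeAlg K ('I_n.-1 + 'I_n)%type -> Prop :=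
  odd_rel (fun k => free_gen K (inl k)) (fun i => free_gen K (inr i)).
Definition odd_t (k : 'I_n.-1) : presented odd_pres := pres_gen odd_pres (inl k).
Definition odd_xi (i : 'I_n) : presented odd_pres := pres_gen odd_pres (inr i).

Lemma pres_pi_scal (G : choiceType) (r : freeAlg K G -> freeAlg K G -> Prop) :
  pres_pi r u%:A = pres_scal r u.
Proof. by rewrite pres_piZ pres_pi1. Qed.

Lemma odd_pres_rel p q : odd_rel odd_t odd_xi p q -> p = q.
Proof.
by apply: (odd_transfer (f := idfun) (g := pres_pi odd_pres)) => // a b; exact: pres_rel.
Qed.

Lemma rat_pres_rel p q :
  rat_rel (pres_scal (@rat_pres K n u) u) (rat_t u) (rat_xi u) (rat_y u) p q -> p = q.
Proof.
apply: (@rat_transfer _ _ _ n idfun (pres_pi (@rat_pres K n u)) _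
  (fun k => free_gen K (RatT k)) _ _ (fun i => free_gen K (RatXi i)) _ _ u%:A _ _
  (fun i => free_gen K (RatY i))) => //; first exact/esym/pres_pi_scal.
by move=> a b; exact: pres_rel.
Qed.

Lemma trig_pres_rel p q :
  trig_rel (pres_scal (@trig_pres K n u) u) (trig_t u) (trig_zeta u) (trig_e u) (trig_eV u) p q
  -> p = q.
Proof.
apply: (@trig_transfer _ _ _ n idfun (pres_pi (@trig_pres K n u)) _
  (fun k => free_gen K (TrigT k)) _ _ (fun i => free_gen K (TrigZeta i)) _ _ u%:A _
  _ _ (fun i => free_gen K (TrigE i)) (fun i => free_gen K (TrigEV i))) => //.
  exact/esym/pres_pi_scal.
by move=> a b; exact: pres_rel.
Qed.

Section Lifts.
Variables (C : pzRingType) (phi : {rmorphism K -> C}).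
Hypothesis phi_central : forall a x, phi a * x = x * phi a.

Lemma free_eval_rmorphism (G : choiceType) (h : G -> C) :
  exists f : {rmorphism freeAlg K G -> C}, f =1 free_eval phi h.
Proof.
pose fm := GRing.isMonoidMorphism.Build _ _ (free_eval phi h)
  (free_eval_is_monoid_morphism h phi_central).
pose f : {rmorphism _ -> _} := HB.pack (free_eval phi h) fm.
by exists f.
Qed.

Lemma free_eval_scal (G : choiceType) (h : G -> C) : free_eval phi h u%:A = phi u.
Proof. by rewrite free_evalZ free_eval1 // mulr1. Qed.

Variables (t : 'I_n.-1 -> C) (xi y y' : 'I_n -> C).

Definition odd_images (g : 'I_n.-1 + 'I_n) : C :=
  match g with inl k => t k | inr i => xi i end.
Definition rat_images (g : rat_gen n) : C :=
  match g with RatT k => t k | RatXi i => xi i | RatY i => y i end.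
Definition trig_images (g : trig_gen n) : C :=
  match g with TrigT k => t k | TrigZeta i => xi i | TrigE i => y i | TrigEV i => y' i end.

Lemma odd_pres_eval : (forall p q, odd_rel t xi p q -> p = q) ->
  forall p q, odd_pres p q -> free_eval phi odd_images p = free_eval phi odd_images q.
Proof.
have [f fE] := free_eval_rmorphism odd_images.
move=> R p q h; rewrite -!fE; apply: (odd_transfer (g := idfun) _ _ R h) => k;
  by rewrite fE free_eval_gen.
Qed.

Lemma rat_pres_eval : (forall p q, rat_rel (phi u) t xi y p q -> p = q) ->
  forall p q, rat_pres u p q -> free_eval phi rat_images p = free_eval phi rat_images q.
Proof.
have [f fE] := free_eval_rmorphism rat_images.
move=> R p q h; rewrite -!fE; apply: (rat_transfer (g := idfun) _ _ _ _ R h) => [k|k||k];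
  by rewrite fE ?free_eval_gen ?free_eval_scal.
Qed.

Lemma trig_pres_eval : (forall p q, trig_rel (phi u) t xi y y' p q -> p = q) ->
  forall p q, trig_pres u p q -> free_eval phi trig_images p = free_eval phi trig_images q.
Proof.
have [f fE] := free_eval_rmorphism trig_images.
move=> R p q h; rewrite -!fE; apply: (trig_transfer (g := idfun) _ _ _ _ _ R h) => [k|k||k|k];
  by rewrite fE ?free_eval_gen ?free_eval_scal.
Qed.
End Lifts.
End Presentations.

(** * Elements of presented algebras and parity *)

Section PresentedInduction.
Variables (K : comNzRingType) (G : choiceType) (r : freeAlg K G -> freeAlg K G -> Prop).

Lemma pres_pi_words p :
  pres_pi r p = \sum_(w <- msupp p) p@_w *: \prod_(g <- w) pres_gen r g.
Proof.
rewrite {1}[p]monalgE raddf_sum /=; apply: eq_bigr => w _.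
have -> : << p@_w *g w >> = p@_w *: << w >> :> freeAlg K G.
  by apply/malgP => v; rewrite mcoeffZ 2!mcoeffU mulr_natr.
rewrite pres_piZ; congr (_ *: _); case: w => w /=; elim: w => [|x w IHw].
  by rewrite -fmoneE -[<< _ >>]/(1 : freeAlg K G) pres_pi1 big_nil.
have -> : << FMonom (x :: w) >> = free_gen K x * << FMonom w >> :> freeAlg K G.
  by rewrite /free_gen unlock malgM_def fgmulUU mulr1; congr (<< _ >>);
    apply/eqP; rewrite fmP fmM fmU.
by rewrite pres_piM IHw big_cons.
Qed.

Lemma pres_gen_ind (P : presented r -> Prop) :
  (forall a, P (pres_scal r a)) -> (forall x y, P x -> P y -> P (x + y)) ->
  (forall x y, P x -> P y -> P (x * y)) -> (forall g, P (pres_gen r g)) ->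
  forall x, P x.
Proof.
move=> Ps PD PM Pg; elim/pres_ind => p; rewrite pres_pi_words.
have Pz : P 0 by have := Ps 0; rewrite /pres_scal scale0r.
have Po : P 1 by have := Ps 1; rewrite /pres_scal scale1r.
apply: big_ind => // w _; rewrite -pres_scalE; apply: (PM) => //.
by apply: big_ind => [|x y|g _]; [exact: Po | exact: PM | exact: Pg].
Qed.
End PresentedInduction.

Section Homogeneous.
Variables (K : comNzRingType) (H : choiceType) (s : freeAlg K H -> freeAlg K H -> Prop).
Variable odd_gen : pred H.
Notation homog := (homogeneous (r := s) odd_gen).

Lemma homogeneous0 d : homog d 0.
Proof. by exists 0; [rewrite raddf0 | move=> w; rewrite msupp0]. Qed.

Lemma homogeneousD d x y : homog d x -> homog d y -> homog d (x + y).
Proof.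
case=> p -> hp [q -> hq]; exists (p + q); first by rewrite pres_piD.
by move=> w /(fsubsetP (msuppD_le _ _)); rewrite in_fsetU => /orP[/hp|/hq].
Qed.

Lemma homogeneousZ d a x : homog d x -> homog d (a *: x).
Proof.
case=> p -> hp; exists (a *: p); first by rewrite pres_piZ.
by move=> w /(fsubsetP (msuppZ_le _ _))/hp.
Qed.

Lemma homogeneousN d x : homog d x -> homog d (- x).
Proof. by move=> h; rewrite -scaleN1r; exact: homogeneousZ. Qed.

Lemma homogeneousM d d' x y : homog d x -> homog d' y -> homog (d (+) d') (x * y).
Proof.
case=> p -> hp [q -> hq]; exists (p * q); first by rewrite pres_piM.
move=> w /msuppM_le[v [v' [/hp <- /hq <- ->]]].
by rewrite /word_parity fmM count_cat oddD.
Qed.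

Lemma homogeneous1 : homog false 1.
Proof.
exists 1; first by rewrite pres_pi1.
by move=> w /(fsubsetP msuppU_le); rewrite in_fset1 => /eqP ->; rewrite /word_parity fm1.
Qed.

Lemma homogeneous_gen g : homog (odd_gen g) (pres_gen s g).
Proof.
exists (free_gen K g) => //; rewrite /free_gen unlock => w /(fsubsetP msuppU_le).
by rewrite in_fset1 => /eqP ->; rewrite /word_parity fmU /= addn0; case: (odd_gen g).
Qed.

Lemma homogeneous_sum d (I : Type) (r : seq I) (P : pred I) (F : I -> presented s) :
  (forall i, P i -> homog d (F i)) -> homog d (\sum_(i <- r | P i) F i).
Proof.
by move=> h; apply: big_ind => //; [exact: homogeneous0 | exact: homogeneousD].
Qed.

Lemma homogeneous_bracket n (t : 'I_n.-1 -> presented s) i j :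
  (forall k, homog true (t k)) -> homog true (bracket t i j).
Proof.
move=> ht; have lt (a b : 'I_n) : (a < b)%N -> homog true (bracket t a b).
  elim/bracket_ind: a b / => [k|a k ak IH]; first by rewrite bracket_adj.
  rewrite bracket_extend //; apply: homogeneousN.
  by rewrite -[true]/(true (+) true (+) true); do 2?apply: homogeneousM.
have [/lt //|ji|/val_inj ->] := ltngtP i j.
  by rewrite bracketC; exact/homogeneousN/lt.
by rewrite /bracket ltnn; exact: homogeneous0.
Qed.

(** Parity is additive on words, so it is enough to look at generators. *)
Lemma homogeneous_morphism (G : choiceType) (r : freeAlg K G -> freeAlg K G -> Prop)
    (oG : pred G) (f : presented r -> presented s) :
  alg_morphism f -> (forall g, homog (oG g) (f (pres_gen r g))) ->
  forall d x, homogeneous oG d x -> homog d (f x).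
Proof.
move=> fA fg d _ [p -> hp]; rewrite pres_pi_words.
have [_ [f1 fM]] := fA.
rewrite (big_morph f (fun x y => alg_morphismD x y fA) (alg_morphism0 fA)).
rewrite big_seq; apply: homogeneous_sum => w /hp <-.
rewrite (alg_morphismZ _ _ fA); apply: homogeneousZ; rewrite /word_parity.
elim: (w : seq G) => [|x v IHv]; first by rewrite big_nil f1; exact: homogeneous1.
rewrite big_cons fM /= oddD; apply: homogeneousM => //.
by have := fg x; case: (oG x).
Qed.
End Homogeneous.

(** * Homomorphisms out of presented algebras *)

Section Morphisms.
Variables (K : comNzRingType) (G : choiceType) (r : freeAlg K G -> freeAlg K G -> Prop).

Lemma alg_morphism_rmorphism (H : choiceType) (s : freeAlg K H -> freeAlg K H -> Prop)
    (f : presented r -> presented s) :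
  alg_morphism f -> exists F : {rmorphism presented r -> presented s},
    F =1 f /\ forall a, F (pres_scal r a) = pres_scal s a.
Proof.
move=> fA; have fB : zmod_morphism f.
  by move=> x y; rewrite alg_morphismD // -scaleN1r alg_morphismZ // scaleN1r.
pose fb := GRing.isZmodMorphism.Build _ _ f fB.
pose fm := GRing.isMonoidMorphism.Build _ _ f fA.2.
pose F : {rmorphism _ -> _} := HB.pack f fb fm.
exists F; split=> // a; rewrite -[LHS]/(f _) alg_morphismZ //.
by have [_ [-> _]] := fA.
Qed.

Lemma alg_morphism_comp (H L : choiceType) (s : freeAlg K H -> freeAlg K H -> Prop)
    (q : freeAlg K L -> freeAlg K L -> Prop)
    (f : presented r -> presented s) (g : presented s -> presented q) :
  alg_morphism f -> alg_morphism g -> alg_morphism (fun x => g (f x)).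
Proof.
move=> [fl [f1 fM]] [gl [g1 gM]]; split=> [a x y|]; first by rewrite fl gl.
by split=> [|x y]; rewrite ?f1 ?g1 ?fM ?gM.
Qed.

Lemma pres_lift_rmorphism (C : pzRingType) (phi : {rmorphism K -> C})
    (phiC : forall a x, phi a * x = x * phi a) (h : G -> C) :
  (forall p q, r p q -> free_eval phi h p = free_eval phi h q) ->
  exists F : {rmorphism presented r -> C},
    (forall g, F (pres_gen r g) = h g) /\ forall a, F (pres_scal r a) = phi a.
Proof.
move=> hr; pose f : presented r -> C := pres_lift phi h (rel := r).
have fZ a x : f (a *: x) = phi a * f x by exact: pres_liftZ.
have fD x y : f (x + y) = f x + f y by exact: pres_liftD.
have fB : zmod_morphism f.
  by move=> x y; rewrite fD -scaleN1r fZ rmorphN1 mulN1r.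
have fM : monoid_morphism f by exact: pres_lift_monoid_morphism.
pose fb := GRing.isZmodMorphism.Build _ _ f fB.
pose fm := GRing.isMonoidMorphism.Build _ _ f fM.
pose F : {rmorphism _ -> _} := HB.pack f fb fm.
exists F; split=> [g|a]; first exact: pres_lift_gen.
by rewrite -[LHS]/(f _) fZ fM.1 mulr1.
Qed.
End Morphisms.

(** * Faithfulness of the Dunkl representation *)

Section Faithfulness.
Variables (K : numFieldType) (n : nat) (u : K).
Notation B := (presented (@odd_pres K n)).
Notation Rat := (presented (@rat_pres K n u)).
Notation E := (endo (regular_point K n -> B)).
Notation ot := (@odd_t K n).
Notation oxi := (@odd_xi K n).
Notation rt := (@rat_t K n u).
Notation rx := (@rat_xi K n u).
Notation ry := (@rat_y K n u).

Variables (odd_to_rat : {rmorphism B -> Rat}) (Phi : {rmorphism Rat -> E}).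
Hypothesis odd_to_rat_scal : forall a, odd_to_rat (pres_scal _ a) = pres_scal _ a.
Hypothesis odd_to_rat_t : forall k, odd_to_rat (ot k) = rt k.
Hypothesis odd_to_rat_xi : forall i, odd_to_rat (oxi i) = rx i.
Hypothesis Phi_scal : forall a, Phi (pres_scal _ a) = endo_scal _ a.
Hypothesis Phi_t : forall k, Phi (rt k) = dunkl_t ot k.
Hypothesis Phi_xi : forall i, Phi (rx i) = dunkl u ot oxi i.
Hypothesis Phi_y : forall i, Phi (ry i) = dunkl_y (odd_pres (K := K) (n := n)) i.

(** A predicate, rather than a subspace: stability under left multiplication by a
    generator is then an induction on its derivations. *)
Inductive normal_ordered : Rat -> Prop :=
| normal_odd b : normal_ordered (odd_to_rat b)
| normal_add x y : normal_ordered x -> normal_ordered y -> normal_ordered (x + y)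
| normal_y i x : normal_ordered x -> normal_ordered (ry i * x).

Let ratR := @rat_pres_rel K n u.

Lemma rat_spinR (p q : Rat) : spin_rel (n := n) rt p q -> p = q.
Proof. by move=> h; exact/ratR/rat_spin. Qed.

Lemma rat_ty (k : 'I_n.-1) i : rt k * ry i = ry (adj k i) * rt k.
Proof.
have := @adj_family _ _ _ rat_spinR false ry _ _ k i; rewrite !mul1r; apply.
- by move=> l a b ha hb; rewrite mul1r; exact/ratR/rat_t_y.
- by move=> l a ha hb; rewrite mul1r; exact/ratR/rat_t_y_far.
Qed.

Lemma normal_ordered_t (k : 'I_n.-1) x : normal_ordered x -> normal_ordered (rt k * x).
Proof.
elim=> [b|a b _ ha _ hb|i a _ ha].
- by rewrite -odd_to_rat_t -rmorphM; exact: normal_odd.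
- by rewrite mulrDr; exact: normal_add.
- by rewrite mulrA rat_ty -mulrA; exact: normal_y.
Qed.

Lemma normal_ordered_scal a x : normal_ordered x -> normal_ordered (pres_scal _ a * x).
Proof.
elim=> [b|y z _ hy _ hz|i y _ hy].
- by rewrite -odd_to_rat_scal -rmorphM; exact: normal_odd.
- by rewrite mulrDr; exact: normal_add.
- by rewrite mulrA pres_scal_central -mulrA; exact: normal_y.
Qed.

Lemma normal_ordered_bracket i j x :
  normal_ordered x -> normal_ordered (bracket rt i j * x).
Proof.
have hN y : normal_ordered y -> normal_ordered (- y).
  by move/(normal_ordered_scal (-1)); rewrite rmorphN1 mulN1r.
have lt (a b : 'I_n) : (a < b)%N -> forall x, normal_ordered x ->
    normal_ordered (bracket rt a b * x).
  elim/bracket_ind: a b / => [k|a k ak IH] y hy.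
    by rewrite bracket_adj; exact: normal_ordered_t.
  rewrite bracket_extend // mulNr -!mulrA.
  by apply/hN/normal_ordered_t/IH/normal_ordered_t.
move=> hx; have [ij|ji|/val_inj ->] := ltngtP i j; first exact: lt.
  by rewrite bracketC mulNr; exact/hN/lt.
by rewrite /bracket ltnn mul0r -(rmorph0 odd_to_rat); exact: normal_odd.
Qed.

(** Moving xi_i across y_j produces only brackets, which are products of t's and
    preserve the span. *)
Lemma normal_ordered_xi i x : normal_ordered x -> normal_ordered (rx i * x).
Proof.
elim=> [b|a b _ ha _ hb|j a ha IH].
- by rewrite -odd_to_rat_xi -rmorphM; exact: normal_odd.
- by rewrite mulrDr; exact: normal_add.
have e : rx i * ry j = ry j * rx i -
   pres_scal _ u * (if j == i then \sum_(k < n | k != i) bracket rt i k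
     else bracket rt j i).
  case: eqVneq => [->|ji].
    by rewrite -(ratR (rat_y_xi_diag _ _ _ _ i)) opprB addrC subrK.
  by rewrite -(ratR (rat_y_xi _ _ _ _ ji)) opprB addrC subrK.
rewrite mulrA e mulrBl -mulrA; apply: normal_add; first exact: normal_y.
rewrite -mulN1r -(rmorphN1 (pres_scal _)) -mulrA.
do 2!apply: normal_ordered_scal; case: ifP => _; last exact: normal_ordered_bracket.
rewrite mulr_suml; apply: big_ind => [|y z|k _].
- by rewrite -(rmorph0 odd_to_rat); exact: normal_odd.
- exact: normal_add.
- exact: normal_ordered_bracket.
Qed.

(** The span is a left ideal that contains 1. *)
Lemma all_normal_ordered x : normal_ordered x.
Proof.
have : forall y, normal_ordered y -> normal_ordered (x * y).
  elim/pres_gen_ind: x => [a|x1 x2 h1 h2|x1 x2 h1 h2|[k|i|i]] y hy.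
  - exact: normal_ordered_scal.
  - by rewrite mulrDl; apply: normal_add; auto.
  - by rewrite -mulrA; auto.
  - exact: normal_ordered_t.
  - exact: normal_ordered_xi.
  - exact: normal_y.
move=> /(_ 1); rewrite mulr1; apply; rewrite -(rmorph1 odd_to_rat); exact: normal_odd.
Qed.

Definition y_monomial (a : {ffun 'I_n -> nat}) : Rat := \prod_(i < n) ry i ^+ a i.

Lemma y_monomialS i a :
  ry i * y_monomial a = y_monomial [ffun j => (j == i) + a j]%N.
Proof.
have yC j k : ry j * ry k = ry k * ry j.
  by have [->//|jk] := eqVneq j k; exact/ratR/rat_y_y.
have -> : ry i = \prod_(j < n) ry j ^+ (j == i).
  rewrite (eq_bigr (fun j => if j == i then ry i else 1)) => [|j _]; last first.
    by case: eqP => [->|_]; rewrite ?expr1 ?expr0.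
  by rewrite -big_mkcond big_pred1_eq.
rewrite /y_monomial -prodrM_comm => [|j k _ _].
  by apply: eq_bigr => j _; rewrite ffunE exprD.
by apply/commrX/commr_sym/commrX/yC.
Qed.

Lemma normal_form x : exists s : seq ({ffun 'I_n -> nat} * B),
  x = \sum_(ab <- s) y_monomial ab.1 * odd_to_rat ab.2.
Proof.
elim: (all_normal_ordered x) => [b|y z _ [s ->] _ [s' ->]|i y _ [s ->]].
- exists [:: ([ffun=> 0%N], b)]; rewrite big_seq1 /y_monomial big1 ?mul1r // => i _.
  by rewrite ffunE.
- by exists (s ++ s'); rewrite big_cat.
- exists [seq ([ffun j => (j == i) + (ab.1 : {ffun 'I_n -> nat}) j]%N, ab.2) | ab <- s].
  rewrite big_map mulr_sumr; apply: eq_bigr => ab _.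
  by rewrite mulrA y_monomialS.
Qed.

Lemma Phi_monomial a m p :
  Phi (y_monomial a) m p = (\prod_(i < n) p i ^+ a i) *: m p.
Proof.
rewrite /y_monomial rmorph_prod; elim: (index_enum _) => [|i r IH].
  by rewrite !big_nil scale1r.
rewrite !big_cons endoME -scalerA -IH rmorphXn /= Phi_y.
elim: (a i) => [|c IHc]; first by rewrite scale1r.
by rewrite !exprS endoME /= IHc scalerA.
Qed.

(** On constant functions the odd part acts by left multiplication, as the divided
    differences vanish there. *)
Lemma Phi_odd b c : Phi (odd_to_rat b) (constfun (K := K) (n := n) c) = constfun (b * c).
Proof.
elim/pres_gen_ind: b c => [a|b b' hb hb'|b b' hb hb'|[k|i]] c.
- by rewrite odd_to_rat_scal Phi_scal; apply/funext => p; rewrite pres_scalE.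
- by rewrite !rmorphD endoDE hb hb'; apply/funext => p; rewrite !fctE /constfun mulrDl.
- by rewrite !rmorphM endoME hb' hb; apply/funext => p; rewrite /constfun mulrA.
- by rewrite odd_to_rat_t Phi_t; apply/funext.
- by rewrite odd_to_rat_xi Phi_xi; exact: dunkl_constant.
Qed.

(** An element \sum y^a b of the kernel sends the constant function 1 to zero, so
    \sum p^a b = 0 at all regular points p, and the coefficient of each y^a is
    zero. *)
Lemma dunkl_faithful : injective Phi.
Proof.
move=> x1 x2 /eqP; rewrite -subr_eq0 -rmorphB => /eqP; set x := x1 - x2 => Px.
suff x0 : x = 0 by apply/eqP; rewrite -subr_eq0 -/x x0.
have [s ex] := normal_form x.
have s0 c : \sum_(ab <- s | ab.1 == c) ab.2 = 0.
  apply: eval_separates => p.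
  transitivity (Phi x (constfun 1) p); last by rewrite Px.
  rewrite ex rmorph_sum endo_sumE fct_sumE; apply: eq_bigr => ab _.
  by rewrite rmorphM endoME Phi_odd Phi_monomial /constfun mulr1.
(* Collect the terms with the same monomial, since s may repeat exponents. *)
have -> : x = \sum_(ab <- s) \sum_(c <- undup (map fst s) | ab.1 == c)
    y_monomial c * odd_to_rat ab.2.
  rewrite ex big_seq [RHS]big_seq; apply: eq_bigr => ab abs.
  rewrite [RHS]big_mkcond (bigD1_seq ab.1) ?undup_uniq ?mem_undup ?map_f //= eqxx.
  by rewrite big1 ?addr0 // => c; rewrite eq_sym => /negbTE ->.
rewrite (exchange_big_dep predT) //= big1 // => c _.
by rewrite -mulr_sumr -rmorph_sum s0 rmorph0 mulr0.
Qed.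
End Faithfulness.

(** * The homomorphism and its localization *)

Section RationalToTrigonometric.
Variables (K : comNzRingType) (n : nat) (u : K).
Notation Rat := (presented (@rat_pres K n u)).
Notation Trig := (presented (@trig_pres K n u)).
Notation Loc := (presented (loc_rel (@rat_y K n u))).
Notation rloc := (loc (@rat_y K n u)).
Notation rt := (@rat_t K n u).
Notation rx := (@rat_xi K n u).
Notation ry := (@rat_y K n u).
Notation tr := (@trig_t K n u).
Notation trz := (@trig_zeta K n u).
Notation tre := (@trig_e K n u).
Notation treV := (@trig_eV K n u).

Definition trig_xi (i : 'I_n) : Trig := treV i * (trz i - pres_scal _ u * jm tr i).

Let trig_eval := rat_pres_eval (pres_scal_central (rel := @trig_pres K n u))
  (trig_rel_rat (pres_scal_central (rel := _) u) (@trig_pres_rel K n u)).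

Definition trig_of_rat : Rat -> Trig :=
  pres_lift (pres_scal _) (rat_images tr trig_xi tre) (rel := @rat_pres K n u).

Lemma trig_of_rat_alg_morphism : alg_morphism trig_of_rat.
Proof. exact: pres_lift_alg_morphism. Qed.

Lemma trig_of_rat_gen g : trig_of_rat (pres_gen _ g) = rat_images tr trig_xi tre g.
Proof. by apply: pres_lift_gen => //; exact: pres_scal_central. Qed.

Lemma trig_of_rat_superalg : superalg_morphism (@rat_odd n) (@trig_odd n) trig_of_rat.
Proof.
split; first exact: trig_of_rat_alg_morphism.
apply: homogeneous_morphism trig_of_rat_alg_morphism _ => -[k|i|i]; rewrite trig_of_rat_gen /=.
- exact: (homogeneous_gen _ (@trig_odd n) (TrigT k)).
- rewrite /trig_xi -[true]/(false (+) true); apply: homogeneousM.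
    exact: (homogeneous_gen _ (@trig_odd n) (TrigEV i)).
  apply: homogeneousD; first exact: (homogeneous_gen _ (@trig_odd n) (TrigZeta i)).
  rewrite pres_scalE; apply/homogeneousN/homogeneousZ/homogeneous_sum => k _.
  by apply: homogeneous_bracket => l; exact: (homogeneous_gen _ (@trig_odd n) (TrigT l)).
- exact: (homogeneous_gen _ (@trig_odd n) (TrigE i)).
Qed.

Lemma trig_of_rat_spin (x : presented (@spin_pres K n)) :
  trig_of_rat (spin_to_rat u x) = spin_to_trig u x.
Proof.
apply: (@alg_morphism_ext _ _ _ _ _ (fun x => trig_of_rat (spin_to_rat u x))) => [||k].
- apply: alg_morphism_comp trig_of_rat_alg_morphism; exact: spin_to_rat_alg_morphism.
- exact: spin_to_trig_alg_morphism.
- by rewrite spin_to_rat_t spin_to_trig_t trig_of_rat_gen.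
Qed.

Lemma trig_of_rat_unique (f : Rat -> Trig) : alg_morphism f ->
  (forall x, f (spin_to_rat u x) = spin_to_trig u x) ->
  (forall i, f (ry i) = tre i) -> (forall i, f (rx i) = trig_xi i) -> f =1 trig_of_rat.
Proof.
move=> fA ft fy fx; apply: alg_morphism_ext fA trig_of_rat_alg_morphism _ => -[k|i|i];
  rewrite trig_of_rat_gen /=; [|exact: fx|exact: fy].
by rewrite -[pres_gen _ _]/(rt k) -spin_to_rat_t ft spin_to_trig_t.
Qed.

Lemma loc_rat_rel p q :
  rat_rel (pres_scal _ u) (fun k => rloc (rt k)) (fun i => rloc (rx i)) (fun i => rloc (ry i)) p q
  -> p = q.
Proof.
have [F [FE Fs]] := alg_morphism_rmorphism (loc_alg_morphism ry).
apply: (@rat_transfer _ _ _ n idfun F _ rt _ _ rx _ _ (pres_scal _ u) _ _ ry) => //.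
- by move=> a b /rat_pres_rel ->.
Qed.

Definition loc_zeta (i : 'I_n) : Loc :=
  rloc (ry i) * rloc (rx i) + pres_scal _ u * jm (fun k => rloc (rt k)) i.

Let loc_eval := trig_pres_eval (pres_scal_central (rel := loc_rel ry))
  (rat_rel_trig (pres_scal_central (rel := _) u) loc_rat_rel (loc_mulV ry) (loc_Vmul ry)).

Definition loc_of_trig : Trig -> Loc :=
  pres_lift (pres_scal _)
    (trig_images (fun k => rloc (rt k)) loc_zeta (fun i => rloc (ry i)) (loc_inv ry))
    (rel := @trig_pres K n u).

Lemma loc_of_trig_alg_morphism : alg_morphism loc_of_trig.
Proof. exact: pres_lift_alg_morphism. Qed.

Lemma loc_of_trig_gen g : loc_of_trig (pres_gen _ g) =
  trig_images (fun k => rloc (rt k)) loc_zeta (fun i => rloc (ry i)) (loc_inv ry) g.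
Proof. by apply: pres_lift_gen => //; exact: pres_scal_central. Qed.

(** The correction u N_i cancels and the inverse of y_i removes y_i. *)
Lemma loc_of_trig_xi i : loc_of_trig (trig_xi i) = rloc (rx i).
Proof.
have [F [FE Fs]] := alg_morphism_rmorphism loc_of_trig_alg_morphism.
rewrite /trig_xi -FE rmorphM rmorphB rmorphM /= Fs !FE.
have -> : loc_of_trig (jm tr i) = jm (fun k => rloc (rt k)) i.
  rewrite -FE /jm rmorph_sum; apply: eq_bigr => k _.
  by apply: (rmorph_bracket (g := idfun)) => l; rewrite FE loc_of_trig_gen.
by rewrite !loc_of_trig_gen /= /loc_zeta addrK mulrA loc_Vmul mul1r.
Qed.

Lemma loc_of_trig_of_rat x : loc_of_trig (trig_of_rat x) = rloc x.
Proof.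
apply: (@alg_morphism_ext _ _ _ _ _ (fun x => loc_of_trig (trig_of_rat x))) => [||[k|i|i]].
- exact: alg_morphism_comp trig_of_rat_alg_morphism loc_of_trig_alg_morphism.
- exact: loc_alg_morphism.
- by rewrite trig_of_rat_gen loc_of_trig_gen.
- by rewrite trig_of_rat_gen loc_of_trig_xi.
- by rewrite trig_of_rat_gen loc_of_trig_gen.
Qed.

Lemma loc_zetaE i : loc_zeta i = rloc (ry i * rx i + u *: jm rt i).
Proof.
have [F [FE Fs]] := alg_morphism_rmorphism (loc_alg_morphism ry).
rewrite -pres_scalE -FE rmorphD !rmorphM /= Fs !FE; congr (_ + _ * _).
rewrite -FE /jm rmorph_sum; apply: eq_bigr => k _.
by apply/esym/(rmorph_bracket (g := idfun)) => l; rewrite FE.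
Qed.

(** The images of the y_i are invertible, so the map extends to the localization;
    both composites with the inverse are the identity on generators. *)
Lemma trig_of_rat_localizes : exists2 phi : Loc -> Trig,
  alg_morphism phi /\ (forall x, phi (rloc x) = trig_of_rat x) &
  cancel phi loc_of_trig /\ cancel loc_of_trig phi.
Proof.
have te_inv i : tre i * treV i = 1 by exact/trig_pres_rel/trig_e_V.
have teV_inv i : treV i * tre i = 1 by exact/trig_pres_rel/trig_V_e.
have [||phi [phiA phi_loc] _] :=
  @loc_universal _ _ _ _ ry _ _ trig_of_rat treV trig_of_rat_alg_morphism.
- by move=> i; rewrite trig_of_rat_gen /= te_inv.
- by move=> i; rewrite trig_of_rat_gen /= teV_inv.
have phi_inv i : phi (loc_inv ry i) = treV i.
  have [_ [phi1 phiM]] := phiA.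
  rewrite -[LHS]mul1r -(teV_inv i) -mulrA -[tre i](trig_of_rat_gen (RatY i)) -phi_loc -phiM.
  by rewrite loc_mulV phi1 mulr1.
exists phi; first by split.
split=> x.
  apply: (@alg_morphism_ext _ _ _ _ _ (fun x => loc_of_trig (phi x)) id) => [|//|[y|i]].
  - exact: alg_morphism_comp phiA loc_of_trig_alg_morphism.
  - by rewrite -[pres_gen _ _]/(rloc y) phi_loc loc_of_trig_of_rat.
  - by rewrite -[pres_gen _ _]/(loc_inv ry i) phi_inv loc_of_trig_gen.
apply: (@alg_morphism_ext _ _ _ _ _ (fun x => phi (loc_of_trig x)) id) => [|//|[k|i|i|i]].
- exact: alg_morphism_comp loc_of_trig_alg_morphism phiA.
- by rewrite loc_of_trig_gen /= phi_loc trig_of_rat_gen.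
- rewrite loc_of_trig_gen /= loc_zetaE phi_loc.
  have [F [FE Fs]] := alg_morphism_rmorphism trig_of_rat_alg_morphism.
  rewrite -pres_scalE -FE rmorphD !rmorphM /= Fs !FE !trig_of_rat_gen /=.
  have -> : trig_of_rat (jm rt i) = jm tr i.
    rewrite -FE /jm rmorph_sum; apply: eq_bigr => k _.
    by apply: (rmorph_bracket (g := idfun)) => l; rewrite FE trig_of_rat_gen.
  by rewrite mulrA te_inv mul1r subrK.
- by rewrite loc_of_trig_gen /= phi_loc trig_of_rat_gen.
- by rewrite loc_of_trig_gen /= phi_inv.
Qed.
End RationalToTrigonometric.

Section Injectivity.
Variables (K : numFieldType) (n : nat) (u : K).

(** The Dunkl operators y_i are invertible, so by [rat_rel_trig] the
    representation extends to the trigonometric algebra.  Composing with iota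
    gives back the faithful representation of the rational one. *)
Lemma trig_of_rat_inj : injective (@trig_of_rat K n u).
Proof.
pose ot := @odd_t K n; pose ox := @odd_xi K n.
pose M := (regular_point K n -> presented (@odd_pres K n)).
have oddR := @odd_pres_rel K n.
have ratR := @dunkl_rat _ _ u _ _ ot ox oddR.
pose dy := dunkl_y (K := K) (n := n) (@odd_pres K n).
pose dyV := dunkl_yV (K := K) (n := n) (@odd_pres K n).
have trigR := rat_rel_trig (endo_scalC (V := M) u) ratR
  (@dunkl_yK _ _ _ _) (@dunkl_yVK _ _ _ _).
have [rho [rho_gen rho_scal]] := pres_lift_rmorphism (@endo_scalC _ _)
  (trig_pres_eval (@endo_scalC _ _) trigR).
have [F [FE Fs]] := alg_morphism_rmorphism (@trig_of_rat_alg_morphism K n u).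
have ratR' p q : odd_rel (@rat_t K n u) (@rat_xi K n u) p q -> p = q.
  by case=> *; apply/rat_pres_rel; [exact: rat_spin|exact: rat_xi_xi|
    exact: rat_t_xi|exact: rat_t_xi_far].
have [embed [embed_gen embed_scal]] := pres_lift_rmorphism (@pres_scal_central _ _ _)
  (odd_pres_eval (@pres_scal_central _ _ _) ratR').
have Phi_inj : injective (rho \o F).
  apply: (@dunkl_faithful _ _ u embed (rho \o F)) => //=.
  - by move=> k; rewrite -[odd_t _ _]/(pres_gen _ _) embed_gen.
  - by move=> i; rewrite -[odd_xi _ _]/(pres_gen _ _) embed_gen.
  - by move=> a; rewrite Fs rho_scal.
  - by move=> k; rewrite FE trig_of_rat_gen rho_gen.
  - move=> i; rewrite FE trig_of_rat_gen /= /trig_xi rmorphM rmorphB rmorphM /= rho_scal !rho_gen /=.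
    have -> : rho (jm (trig_t u) i) = jm (dunkl_t ot) i.
      rewrite /jm rmorph_sum; apply: eq_bigr => k _.
      by apply: (rmorph_bracket (g := idfun)) => l; rewrite rho_gen.
    by rewrite addrK mulrA dunkl_yVK mul1r.
  - by move=> i; rewrite FE trig_of_rat_gen rho_gen.
by move=> x y xy; apply: Phi_inj; rewrite /= !FE xy.
Qed.
End Injectivity.

Theorem theorem5p6 (R : realType) (n : nat) (u : R[i])
    (n_ge1 : (1 <= n)%N) (u_neq0 : u != 0) :
  exists iota : rat_sDAHA n u -> trig_sDAHA n u,
    let is_iota (f : rat_sDAHA n u -> trig_sDAHA n u) : Prop :=
      [/\ superalg_morphism (@rat_odd n) (@trig_odd n) f,
          forall x : spin_group_alg R[i] n,
            f (spin_to_rat u x) = spin_to_trig u x,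
          forall i : 'I_n, f (rat_y u i) = trig_e u i &
          forall i : 'I_n,
            f (rat_xi u i) =
              trig_eV u i *
              (trig_zeta u i - u *: \sum_(k < n | (k < i)%N)
                                     bracket (@trig_t _ n u) k i)] in
    [/\ is_iota iota,
        forall f : rat_sDAHA n u -> trig_sDAHA n u, is_iota f -> f =1 iota,
        injective iota &
        exists (phi : rat_sDAHA_loc n u -> trig_sDAHA n u)
               (j : trig_sDAHA n u -> rat_sDAHA_loc n u),
          [/\ alg_morphism phi /\ alg_morphism j,
              cancel phi j /\ cancel j phi,
              forall x : rat_sDAHA n u, phi (loc (@rat_y _ n u) x) = iota x,
              forall x : spin_group_alg R[i] n,
                j (spin_to_trig u x) = loc (@rat_y _ n u) (spin_to_rat u x) &
              forall i : 'I_n,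
                j (trig_e u i) = loc (@rat_y _ n u) (rat_y u i) /\
                j (trig_zeta u i) =
                  loc (@rat_y _ n u)
                    (rat_y u i * rat_xi u i +
                     u *: \sum_(k < n | (k < i)%N)
                            bracket (@rat_t _ n u) k i)]].
Proof.
exists (@trig_of_rat _ n u) => is_iota; split.
- split=> [|x|i|i]; [exact: trig_of_rat_superalg|exact: trig_of_rat_spin| |];
    by rewrite trig_of_rat_gen //= /trig_xi pres_scalE.
- move=> f [[fA _] ft fy fx]; apply: trig_of_rat_unique => // i.
  by rewrite fx /trig_xi pres_scalE.
- exact: trig_of_rat_inj.
have [phi [phiA phi_loc] phiK] := @trig_of_rat_localizes _ n u.
exists phi, (@loc_of_trig _ n u); split=> //.
- by split=> //; exact: loc_of_trig_alg_morphism.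
- by move=> x; rewrite -trig_of_rat_spin loc_of_trig_of_rat.
- move=> i; rewrite -[trig_e u i]/(pres_gen _ _) -[trig_zeta u i]/(pres_gen _ _).
  by rewrite !loc_of_trig_gen /= loc_zetaE.
Qed.
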